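(* Let $p$ be an odd prime, $A\subseteq \mathbb{F}_p$ a nonempty set and $1\le M \le p/(2|A|)$ a parameter. Then there exist two disjoint subsets $B$ and $C$ of $A$ with $A = B\sqcup C$ such that $$\mathsf{E}^{+} (B) - \frac{|B|^4}{p} \le \frac{|A|^{2/3} |B|^{7/3}}{M},$$ and for any set $X \subseteq \mathbb{F}_p$ one has $$\mathsf{E}^{\times} (C,X) \lesssim \frac{M^2 |X|^2 |A|^2 }{p} + M^{3/2} |A| |X|^{3/2}.$$
   Context: $\mathsf{E}^+(B)$ is the number of $(b_1,\dots,b_4)\in B^4$ with $b_1+b_2=b_3+b_4$. $\mathsf{E}^\times(C,X)$ is the number of $(c_1,c_2,x_1,x_2)\in C^2\times X^2$ with $c_1x_1=c_2x_2$. $a\lesssim b$ means $a=O(b\log^c|A|)$ for some absolute constant $c>0$.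
   Formalization: The multiplicative bound is proved for E^×(C∖{0}, X∖{0}), since zero solutions make the printed bound false (A={0}, M=2, X=F_p, p large), and log|A| is read as max(1, log|A|), since log 1 = 0 breaks the case |A|=1. *)

(* Defs.v *)
From HB Require Import structures.
From mathcomp Require Import all_boot all_order all_algebra.
From mathcomp Require Import all_classical all_reals all_analysis.

Set Implicit Arguments.
Unset Strict Implicit.
Unset Printing Implicit Defensive.

Import Order.TTheory GRing.Theory Num.Theory.

Local Open Scope ring_scope.

Definition add_energy (F : finFieldType) (B : {set F}) : nat :=
  #|[set q : F * F * F * F | let: (b1, b2, b3, b4) := q in
      [&& b1 \in B, b2 \in B, b3 \in B, b4 \in B & b1 + b2 == b3 + b4]]|.

Definition mul_energy (F : finFieldType) (C X : {set F}) : nat :=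
  #|[set q : F * F * F * F | let: (c1, c2, x1, x2) := q in
      [&& c1 \in C, c2 \in C, x1 \in X, x2 \in X & c1 * x1 == c2 * x2]]|.

(* The bound a = O(b log^c n), with implied constant K.  The logarithm is
   truncated below at 1: this only matters for n <= 2, and for n = 1 the
   untruncated factor ln 1 would be zero. *)
Definition le_up_to_log (R : realType) (K c : R) (n : nat) (a b : R) : Prop :=
  a <= K * (Num.max 1 (ln n%:R)) `^ c * b.

(* Main.v *)
(* The set A is emptied of additive structure: while the current set B has large
   additive energy, let S be the set of its popular sums and remove from B the
   set D of all d having many representations d = s - b with s in S and b in B.
   Each solution of c1 x1 = c2 x2 with c1, c2 in D then yields many solutions of
     x (s - b) = x' (s' - b') <> 0,
   so it suffices to bound their number Q in terms of N = |S||B||X|.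

   If N exceeds a multiple of p^2, a second moment over all planes of F_p^3
   gives Q <= N^2 / p + p N.  Otherwise Q counts, over an extension K of F_p,
   the crossings between two families of N lines of K^3 whose directions lie on
   the conic (1, w, w^2).  If there are too many crossings, pass to a subfamily
   in which every line has many crossings, and let F be a nonzero polynomial of
   least degree vanishing on all its lines; the degree of F is O(sqrt N).  At a
   crossing, the tangent plane of F = 0 contains two directions of the conic,
   and the second fundamental form vanishes on both, so each line consists
   entirely of such "umbilic" points.  Differentiating this once more along the
   crossing lines shows that, along a line of slope w on which F is not
   singular, 1 / (w' - w) is an affine function of the position, w' being the
   slope of the second direction.  Hence all lines crossing the given one lie on
   a common quadric, and the product structure of S x B x X bounds their
   number by |S| + |B|, a contradiction. *)
Require Import Defs.
From HB Require Import structures.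
From mathcomp Require Import all_boot all_order all_algebra.
From mathcomp Require Import ring lra zify.
From mathcomp Require mpoly.

Set Implicit Arguments.
Unset Strict Implicit.
Unset Printing Implicit Defensive.

Import Order.TTheory GRing.Theory Num.Theory.

Local Open Scope ring_scope.

(** * Polynomials vanishing on null rays *)

Module NullRays.

Import mpoly.

Definition i0 : 'I_3 := @Ordinal 3 0 isT.
Definition i1 : 'I_3 := @Ordinal 3 1 isT.
Definition i2 : 'I_3 := @Ordinal 3 2 isT.

Lemma big_I3 (R : nmodType) (f : 'I_3 -> R) : \sum_i f i = f i0 + f i1 + f i2.
Proof.
rewrite 3!big_ord_recl big_ord0 addr0 addrA; congr (_ + _ + _); congr (f _);
exact: val_inj.
Qed.

Lemma prod_I3 (R : comPzRingType) (f : 'I_3 -> R) :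
  \prod_i f i = f i0 * f i1 * f i2.
Proof.
rewrite 3!big_ord_recl big_ord0 mulr1 mulrA; congr (_ * _ * _); congr (f _);
exact: val_inj.
Qed.

(* The direction (1, w, w ^ 2) is null for y ^ 2 - x z. *)
Definition ray (K : fieldType) (r : K * K * K) (i : 'I_3) : {poly K} :=
  let: (u, v, w) := r in
  nth 0 [:: u%:P + 'X; w *: 'X; v%:P + w ^+ 2 *: 'X] i.

HB.lock Definition restr (K : fieldType) (r : K * K * K) (F : {mpoly K[3]}) : {poly K} :=
  mmap (@polyC K) (ray r) F.
HB.lock Definition dx (K : fieldType) (F : {mpoly K[3]}) : {mpoly K[3]} := mderiv i0 F.
HB.lock Definition dy (K : fieldType) (F : {mpoly K[3]}) : {mpoly K[3]} := mderiv i1 F.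
HB.lock Definition dz (K : fieldType) (F : {mpoly K[3]}) : {mpoly K[3]} := mderiv i2 F.
HB.lock Definition dir (K : fieldType) (w : K) (F : {mpoly K[3]}) : {mpoly K[3]} :=
  dx F + w *: dy F + w ^+ 2 *: dz F.

(** * Derivatives of a polynomial at a crossing of two rays *)

Section Rays.

Variable K : fieldType.
Implicit Types (F : {mpoly K[3]}) (u v w : K).

Lemma chain_rule (g : 'I_3 -> {poly K}) F :
  (mmap (@polyC K) g F)^`() =
  \sum_i mmap (@polyC K) g (mderiv i F) * (g i)^`().
Proof.
elim/mpolyind: F => [|c m p _ _ IH].
  by rewrite mmap0 deriv0 big1 // => i _; rewrite mderiv0 mmap0 mul0r.
rewrite mmapD derivD IH mmapZ mmapX.
under [RHS]eq_bigr => i _ do rewrite mderivD mderivZ mderivX mmapD mmapZ mmapZ mmapX mulrDl.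
rewrite big_split /=; congr (_ + _).
rewrite derivM derivC mul0r add0r.
suff -> : (mmap1 g m)^`() = \sum_i (m i)%:R *: (mmap1 g (m - U_(i))%MM * (g i)^`()).
  by rewrite mulr_sumr; apply: eq_bigr => i _; rewrite -!mul_polyC !mulrA.
rewrite /mmap1 big_I3 !prod_I3 !mnmBE !mnm1E /=.
rewrite !subn0 !subn1 !derivM -!mul_polyC !polyC_natr.
have dX (q : {poly K}) n : (q ^+ n)^`() = q^`() * q ^+ n.-1 * n%:R.
  by rewrite deriv_exp mulr_natr.
rewrite !dX; ring.
Qed.

(** The coordinates of a ray have degree at most 1, so restriction does not raise the degree of a
    monomial. *)
Lemma size_restr r F : (size (restr r F) <= msize F)%N.
Proof.
rewrite restr.unlock /mmap; apply: leq_trans (size_sum _ _ _) _.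
rewrite big_tnth; apply/bigmax_leqP => i _.
have := mem_tnth i (in_tuple (msupp F)); set m := tnth _ i => mF.
rewrite mul_polyC; apply: leq_trans (size_scale_leq _ _) _.
apply: leq_trans (msize_mdeg_lt mF).
rewrite /mmap1 mdegE; apply: leq_trans (size_poly_prod_leq _ _) _.
have sz j : (size (ray r j ^+ m j) <= (m j).+1)%N.
  apply: leq_trans (size_poly_exp_leq _ _) _; rewrite ltnS.
  have : (size (ray r j) <= 2)%N.
    case: r => -[u v] w; rewrite /ray; case: j => -[|[|[|j]]] // _ /=.
    - by rewrite addrC size_XaddC.
    - by apply: leq_trans (size_scale_leq _ _) _; rewrite size_polyX.
    apply: leq_trans (size_polyD _ _) _; rewrite geq_max.
    by rewrite (leq_trans (size_polyC_leq1 _)) // (leq_trans (size_scale_leq _ _)) //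
      size_polyX.
  by case: (size _) => [|[|[|]]] // _; rewrite /= ?mul0n ?mul1n.
have : (\sum_(j < 3) size (ray r j ^+ m j) <= \sum_(j < 3) (m j + 1))%N.
  by apply: leq_sum => j _; rewrite addn1.
rewrite big_split /= sum_nat_const card_ord => le_sum.
by rewrite leq_subLR addSn ltnS (leq_trans le_sum) // muln1 addnC leq_add2l.
Qed.

Lemma restr_deriv u v w F :
  (restr (u, v, w) F)^`() = restr (u, v, w) (dir w F).
Proof.
rewrite dir.unlock restr.unlock chain_rule big_I3 dx.unlock dy.unlock dz.unlock !mmapD
  !mmapZ /ray /=.
move: (mmap _ _ _) (mmap _ _ _) (mmap _ _ _) => a b c.
by rewrite !derivE -!mul_polyC polyC_exp; ring.
Qed.

Definition pt (r : K * K * K) (t : K) (i : 'I_3) : K := (ray r i).[t].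

Lemma horner_restr r F t : (restr r F).[t] = meval (pt r t) F.
Proof.
rewrite restr.unlock /mmap mevalE horner_sum; apply: eq_bigr => m _.
rewrite hornerM hornerC /mmap1; congr (_ * _).
by rewrite horner_prod; apply: eq_bigr => i _; rewrite horner_exp.
Qed.

Definition meet (r r' : K * K * K) (t t' : K) : Prop :=
  let: (u, v, w) := r in let: (u', v', w') := r' in
  [/\ u + t = u' + t', w * t = w' * t' & v + w ^+ 2 * t = v' + w' ^+ 2 * t'].

Lemma meet_sym r r' t t' : meet r r' t t' -> meet r' r t' t.
Proof. by case: r r' => [[u v] w] [[u' v'] w'] []. Qed.

Lemma restr_meet r r' t t' F : meet r r' t t' ->
  (restr r F).[t] = (restr r' F).[t'].
Proof.
case: r r' => [[u v] w] [[u' v'] w'] [e1 e2 e3]; rewrite !horner_restr.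
apply: meval_eq => i; rewrite /pt /ray.
by case: i => -[|[|[|i]]] // _ /=; rewrite !hornerE.
Qed.

(* Up to a factor, the second derivative of F in the direction (1, w', w' ^ 2),
   where w' = c / a is the other root, besides w, of F_x + z F_y + z ^ 2 F_z. *)
Definition psi (r : K * K * K) F : {poly K} :=
  let a := restr r (dz F) in
  let c := - (restr r (dy F) + r.2 *: a) in
  a ^+ 4 * restr r (dx (dx F)) + 2 *: (a ^+ 3 * c * restr r (dx (dy F)))
  + a ^+ 2 * c ^+ 2 * (restr r (dy (dy F)) + 2 *: restr r (dx (dz F)))
  + 2 *: (a * c ^+ 3 * restr r (dy (dz F))) + c ^+ 4 * restr r (dz (dz F)).

Lemma dyx F : dy (dx F) = dx (dy F).
Proof. by rewrite dx.unlock dy.unlock mderiv_comm. Qed.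
Lemma dzx F : dz (dx F) = dx (dz F).
Proof. by rewrite dx.unlock dz.unlock mderiv_comm. Qed.
Lemma dzy F : dz (dy F) = dy (dz F).
Proof. by rewrite dy.unlock dz.unlock mderiv_comm. Qed.

Lemma restrD r F G : restr r (F + G) = restr r F + restr r G.
Proof. by rewrite restr.unlock mmapD. Qed.

Lemma restrZ r c F : restr r (c *: F) = c *: restr r F.
Proof. by rewrite restr.unlock mmapZ mul_polyC. Qed.

Lemma dirE r w F : restr r (dir w F) =
  restr r (dx F) + w *: restr r (dy F) + w ^+ 2 *: restr r (dz F).
Proof. by rewrite dir.unlock !restrD !restrZ. Qed.

Lemma dx_dir w F : dx (dir w F) = dir w (dx F).
Proof.
rewrite dir.unlock; have D G H : dx (G + H) = dx G + dx H by rewrite dx.unlock mderivD.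
have Z c G : dx (c *: G) = c *: dx G by rewrite dx.unlock mderivZ.
by rewrite !(D, Z) dyx dzx.
Qed.
Lemma dy_dir w F : dy (dir w F) = dir w (dy F).
Proof.
rewrite dir.unlock; have D G H : dy (G + H) = dy G + dy H by rewrite dy.unlock mderivD.
have Z c G : dy (c *: G) = c *: dy G by rewrite dy.unlock mderivZ.
by rewrite !(D, Z) dyx dzy.
Qed.
Lemma dz_dir w F : dz (dir w F) = dir w (dz F).
Proof.
rewrite dir.unlock; have D G H : dz (G + H) = dz G + dz H by rewrite dz.unlock mderivD.
have Z c G : dz (c *: G) = c *: dz G by rewrite dz.unlock mderivZ.
by rewrite !(D, Z) dzx dzy.
Qed.

Lemma restr_dir0 u v w F : restr (u, v, w) F = 0 -> restr (u, v, w) (dir w F) = 0.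
Proof. by move=> h; rewrite -restr_deriv h deriv0. Qed.

Lemma horner_dir r w F t : (restr r (dir w F)).[t] =
  (restr r (dx F)).[t] + w * (restr r (dy F)).[t] + w ^+ 2 * (restr r (dz F)).[t].
Proof. by rewrite dirE !hornerD !hornerZ. Qed.

(** The derivatives of F along both rays vanish at the crossing, so F_x + z F_y + z^2 F_z has the
    distinct roots w and w'. Vieta's formulas then express F_x and F_y through F_z. *)
Lemma meet_gradient u v w u' v' w' t t' F :
  restr (u, v, w) F = 0 -> restr (u', v', w') F = 0 -> w != w' ->
  meet (u, v, w) (u', v', w') t t' ->
  let g := (restr (u, v, w) (dz F)).[t] in
  (restr (u, v, w) (dy F)).[t] = - (w + w') * g /\
  (restr (u, v, w) (dx F)).[t] = w * w' * g.
Proof.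
move=> h h' nw mt g.
have e : (restr (u, v, w) (dir w F)).[t] = 0 by rewrite restr_dir0 ?horner0.
have e' : (restr (u, v, w) (dir w' F)).[t] = 0.
  by rewrite (restr_meet _ mt) restr_dir0 ?horner0.
move: e e'; rewrite !horner_dir -/g.
set fx := (restr _ (dx F)).[t]; set fy := (restr _ (dy F)).[t] => e e'.
have d0 : w - w' != 0 by rewrite subr_eq0.
have fxE : fx = - (w * fy + w ^+ 2 * g) by rewrite -[LHS]subr0 -e; ring.
have fyE : fy = - (w + w') * g.
  by apply/(mulfI d0)/subr0_eq; rewrite -[RHS]oppr0 -e' fxE; ring.
by split=> //; rewrite fxE fyE; ring.
Qed.

Lemma horner_psi u v w F t :
  let e G := (restr (u, v, w) G).[t] in
  let a := e (dz F) in let c := - (e (dy F) + w * a) in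
  (psi (u, v, w) F).[t] =
    a ^+ 4 * e (dx (dx F)) + 2 * (a ^+ 3 * c * e (dx (dy F)))
    + a ^+ 2 * c ^+ 2 * (e (dy (dy F)) + 2 * e (dx (dz F)))
    + 2 * (a * c ^+ 3 * e (dy (dz F))) + c ^+ 4 * e (dz (dz F)).
Proof.
rewrite /psi /=.
move: (restr _ (dz F)) (restr _ (dy F)) (restr _ (dx (dx F))) (restr _ (dx (dy F)))
  (restr _ (dx (dz F))) (restr _ (dy (dy F))) (restr _ (dy (dz F))) (restr _ (dz (dz F))).
by move=> a b p1 p2 p3 p4 p5 p6; rewrite !(hornerE, horner_exp).
Qed.

(** By [meet_gradient], c = w' a at the crossing. So [psi] is there a^4 times the second derivative
    of F along the second ray, on which F vanishes. *)
Lemma psi_meet u v w u' v' w' t t' F :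
  restr (u, v, w) F = 0 -> restr (u', v', w') F = 0 -> w != w' ->
  meet (u, v, w) (u', v', w') t t' -> (psi (u, v, w) F).[t] = 0.
Proof.
move=> h h' nw mt; have [ey _] := meet_gradient h h' nw mt.
have : (restr (u, v, w) (dir w' (dir w' F))).[t] = 0.
  by rewrite (restr_meet _ mt) !restr_dir0 ?horner0.
rewrite horner_dir dx_dir dy_dir dz_dir !horner_dir dyx dzx dzy.
rewrite horner_psi /= ey.
move: (restr _ (dz F)).[t] => g e.
rewrite -[RHS](mulr0 (g ^+ 4)) -e; ring.
Qed.

(* Up to a factor, the second derivative of a / b, where w' = w - b / a is the
   other root, besides w, of F_x + z F_y + z ^ 2 F_z. *)
Definition lam (r : K * K * K) F : {poly K} :=
  let a := restr r (dz F) in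
  let b := restr r (dy F) + (2 * r.2) *: a in
  (a^`()^`() * b - a * b^`()^`()) * b - 2 *: (b^`() * (a^`() * b - a * b^`())).

Lemma horner_deriv_psi u v w F t :
  let e G := (restr (u, v, w) G).[t] in
  let a := e (dz F) in let a' := e (dir w (dz F)) in
  let c := - (e (dy F) + w * a) in let c' := - (e (dir w (dy F)) + w * a') in
  (psi (u, v, w) F)^`().[t] =
    a ^+ 4 * e (dir w (dx (dx F))) + 2 * (a ^+ 3 * c * e (dir w (dx (dy F))))
    + a ^+ 2 * c ^+ 2 * (e (dir w (dy (dy F))) + 2 * e (dir w (dx (dz F))))
    + 2 * (a * c ^+ 3 * e (dir w (dy (dz F)))) + c ^+ 4 * e (dir w (dz (dz F)))
    + 2 * (2 * a ^+ 3 * a' * e (dx (dx F))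
           + (3 * a ^+ 2 * a' * c + a ^+ 3 * c') * e (dx (dy F))
           + (a * a' * c ^+ 2 + a ^+ 2 * c * c') * (e (dy (dy F)) + 2 * e (dx (dz F)))
           + (a' * c ^+ 3 + 3 * a * c ^+ 2 * c') * e (dy (dz F))
           + 2 * c ^+ 3 * c' * e (dz (dz F))).
Proof.
rewrite /psi /= -!restr_deriv.
move: (restr _ (dz F)) (restr _ (dy F)) (restr _ (dx (dx F))) (restr _ (dx (dy F)))
  (restr _ (dx (dz F))) (restr _ (dy (dy F))) (restr _ (dy (dz F))) (restr _ (dz (dz F))).
move=> a b p1 p2 p3 p4 p5 p6.
rewrite !(derivD, derivZ, derivM, derivN, deriv_exp) !(hornerD, hornerZ, hornerM, hornerN,
  horner_exp, hornerMn) /=; ring.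
Qed.

Lemma horner_lam u v w F t :
  let e G := (restr (u, v, w) G).[t] in
  let a := e (dz F) in let a' := e (dir w (dz F)) in
  let a'' := e (dir w (dir w (dz F))) in
  let b := e (dy F) + 2 * w * a in let b' := e (dir w (dy F)) + 2 * w * a' in
  let b'' := e (dir w (dir w (dy F))) + 2 * w * a'' in
  (lam (u, v, w) F).[t] =
  (a'' * b - a * b'') * b - 2 * (b' * (a' * b - a * b')).
Proof.
rewrite /lam /= -!restr_deriv.
move: (restr _ (dz F)) (restr _ (dy F)) => a b.
by rewrite !derivE !hornerE /=.
Qed.

(** Seen from the second ray, the other root at the crossing is w. Differentiating [psi] = 0 along
    the second ray thus gives a third-order relation. Together with the vanishing of the second
    derivatives along both rays and of the third along the first, it yields [lam] up to the nonzero
    factor (w - w') g^2. *)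
Lemma lam_meet u v w u' v' w' t t' F :
  restr (u, v, w) F = 0 -> restr (u', v', w') F = 0 -> w != w' ->
  meet (u, v, w) (u', v', w') t t' -> psi (u', v', w') F = 0 ->
  (restr (u, v, w) (dz F)).[t] != 0 -> (lam (u, v, w) F).[t] = 0.
Proof.
move=> h h' nw mt psi0 g0; have [ey _] := meet_gradient h h' nw mt.
have E1 : (restr (u, v, w) (dir w (dir w F))).[t] = 0.
  by rewrite !restr_dir0 ?horner0.
have E3 : (restr (u, v, w) (dir w (dir w (dir w F)))).[t] = 0.
  by rewrite !restr_dir0 ?horner0.
have E2 : (restr (u, v, w) (dir w' (dir w' F))).[t] = 0.
  by rewrite (restr_meet _ mt) !restr_dir0 ?horner0.
have E4 : (psi (u', v', w') F)^`().[t'] = 0 by rewrite psi0 deriv0 horner0.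
have dxy (G : {mpoly K[3]}) : dx (dy G) = dy (dx G) by rewrite dyx.
have dxz (G : {mpoly K[3]}) : dx (dz G) = dz (dx G) by rewrite dzx.
have dyz (G : {mpoly K[3]}) : dy (dz G) = dz (dy G) by rewrite dzy.
have d0 : w - w' != 0 by rewrite subr_eq0.
rewrite horner_lam.
move: E4; rewrite horner_deriv_psi /= -!(restr_meet _ mt).
rewrite !(dx_dir, dy_dir, dz_dir, horner_dir) in E1 E2 E3 *.
rewrite !(dxy, dxz, dyz) in E1 E2 E3 *.
rewrite ?ey.
set g := (restr _ (dz F)).[t] in g0 *.
move: E1 E2 E3.
set xx := (restr _ (dx (dx F))).[t].
set xy := (restr _ (dy (dx F))).[t].
set xz := (restr _ (dz (dx F))).[t].
set yy := (restr _ (dy (dy F))).[t].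
set yz := (restr _ (dz (dy F))).[t].
set zz := (restr _ (dz (dz F))).[t].
set xxx := (restr _ (dx (dx (dx F)))).[t].
set xxy := (restr _ (dy (dx (dx F)))).[t].
set xxz := (restr _ (dz (dx (dx F)))).[t].
set xyy := (restr _ (dy (dy (dx F)))).[t].
set xyz := (restr _ (dz (dy (dx F)))).[t].
set xzz := (restr _ (dz (dz (dx F)))).[t].
set yyy := (restr _ (dy (dy (dy F)))).[t].
set yyz := (restr _ (dz (dy (dy F)))).[t].
set yzz := (restr _ (dz (dz (dy F)))).[t].
set zzz := (restr _ (dz (dz (dz F)))).[t].
move=> E1 E2 E3 E4.
(* The vanishing second and third derivatives along the first ray eliminate [xx] and [xxx]. *)
have xxE : xx = - (2 * w * xy + w ^+ 2 * (yy + 2 * xz) + 2 * w ^+ 3 * yz + w ^+ 4 * zz).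
  by rewrite -[LHS]subr0 -E1; ring.
have xxxE : xxx = - (3 * w * xxy + 3 * w ^+ 2 * (xxz + xyy) + w ^+ 3 * (yyy + 6 * xyz)
    + 3 * w ^+ 4 * (xzz + yyz) + 3 * w ^+ 5 * yzz + w ^+ 6 * zzz).
  by rewrite -[LHS]subr0 -E3; ring.
move: E2 E4; rewrite xxE xxxE {E1 E3 xxE xxxE}.
set e2 := (X in X = 0 -> _) => E2; set e4 := (X in X = 0 -> _) => E4.
have g2 : (w - w') * g ^+ 2 != 0 by rewrite mulf_neq0 ?expf_neq0.
apply: (mulfI g2); rewrite mulr0.
(* This is the value at the crossing of the derivative of the denominator b in [lam]. *)
pose b' := xy + w * yy + w ^+ 2 * yz + 2 * w * (xz + w * yz + w ^+ 2 * zz).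
transitivity ((w - w') * e4 - 2 * g ^+ 3 * b' * e2); last by rewrite E2 E4; ring.
by rewrite /e2 /e4 /b'; ring.
Qed.

End Rays.

(** * Degree bounds and ratios of polynomials *)

Section DegreeBounds.

Variable K : fieldType.
Implicit Types (F : {mpoly K[3]}) (p q : {poly K}).

Lemma size_polyD_leq n p q : (size p <= n)%N -> (size q <= n)%N -> (size (p + q)%R <= n)%N.
Proof. by move=> hp hq; rewrite (leq_trans (size_polyD _ _)) // geq_max hp. Qed.

Lemma size_polyN_leq n p : (size p <= n)%N -> (size (- p)%R <= n)%N.
Proof. by rewrite size_polyN. Qed.

Lemma size_polyZ_leq n c p : (size p <= n)%N -> (size (c *: p)%R <= n)%N.
Proof. exact/leq_trans/size_scale_leq. Qed.

Lemma size_polyM_addn m n p q :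
  (size p <= m)%N -> (size q <= n)%N -> (size (p * q)%R <= m + n)%N.
Proof. by move=> hp hq;
  rewrite (leq_trans (size_polyMleq _ _)) // (leq_trans (leq_pred _)) // leq_add. Qed.

Lemma size_polyX_muln n k p : (size p <= n)%N -> (size (p ^+ k.+1)%R <= k.+1 * n)%N.
Proof.
move=> hp; elim: k => [|k IH]; first by rewrite expr1 mul1n.
by rewrite exprS mulSn size_polyM_addn.
Qed.

Lemma size_deriv_leq n p : (size p <= n)%N -> (size p^`() <= n)%N.
Proof. by move=> hp; rewrite (leq_trans (size_poly _ _)) // (leq_trans (leq_pred _)). Qed.

Lemma msize_mderiv (i : 'I_3) F : (msize (mderiv i F) <= (msize F).-1)%N.
Proof.
rewrite msizeE big_seq; apply/bigmax_leqP_seq => m mF _.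
have : mcoeff (m + U_(i)) F != 0.
  by move: mF; rewrite mcoeff_msupp mcoeff_mderiv; apply: contraNneq => ->; rewrite mul0rn.
by rewrite -mcoeff_msupp => /msize_mdeg_lt; rewrite mdegD mdeg1 addn1 ltn_predRL.
Qed.

Lemma size_restr_leq r n F : (msize F <= n)%N -> (size (restr r F) <= n)%N.
Proof. exact/leq_trans/size_restr. Qed.

Lemma msize_dx n F : (msize F <= n)%N -> (msize (dx F) <= n)%N.
Proof. by rewrite dx.unlock => h;
  rewrite (leq_trans (msize_mderiv _ _)) // (leq_trans (leq_pred _)). Qed.
Lemma msize_dy n F : (msize F <= n)%N -> (msize (dy F) <= n)%N.
Proof. by rewrite dy.unlock => h;
  rewrite (leq_trans (msize_mderiv _ _)) // (leq_trans (leq_pred _)). Qed.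
Lemma msize_dz n F : (msize F <= n)%N -> (msize (dz F) <= n)%N.
Proof. by rewrite dz.unlock => h;
  rewrite (leq_trans (msize_mderiv _ _)) // (leq_trans (leq_pred _)). Qed.

(** [psi] is homogeneous of degree 5 in the restricted derivatives of F. *)
Lemma size_psi r n F : (msize F <= n)%N -> (size (psi r F) <= 5 * n)%N.
Proof.
move=> hF; have sx := size_restr_leq r (msize_dx hF).
have sy := size_restr_leq r (msize_dy hF); have sz := size_restr_leq r (msize_dz hF).
have s2 G : (msize G <= n)%N -> (size (restr r G) <= n)%N by exact: size_restr_leq.
have sxx := s2 _ (msize_dx (msize_dx hF)); have sxy := s2 _ (msize_dx (msize_dy hF)).
have sxz := s2 _ (msize_dx (msize_dz hF)); have syy := s2 _ (msize_dy (msize_dy hF)).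
have syz := s2 _ (msize_dy (msize_dz hF)); have szz := s2 _ (msize_dz (msize_dz hF)).
rewrite /psi; set a := restr r (dz F) in sz *.
set c := - _; have sc : (size c <= n)%N.
  by apply/size_polyN_leq/size_polyD_leq => //; apply: size_polyZ_leq.
have M5 k l p q : (size p <= k * n)%N -> (size q <= l * n)%N -> (k + l = 5)%N ->
  (size (p * q)%R <= 5 * n)%N.
  by move=> h1 h2 <-; rewrite mulnDl size_polyM_addn.
do !apply: size_polyD_leq; try apply: size_polyZ_leq.
- by apply: (M5 4 1)%N; rewrite ?mul1n // size_polyX_muln.
- apply: (M5 4 1)%N; rewrite ?mul1n //.
  by rewrite -[X in (_ <= X)%N]/(n + 3 * n)%N addnC size_polyM_addn // size_polyX_muln.
- apply: (M5 4 1)%N; rewrite ?mul1n //.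
    by rewrite -[4%N]/(2 + 2)%N mulnDl size_polyM_addn ?size_polyX_muln.
  by apply: size_polyD_leq => //; apply: size_polyZ_leq.
- apply: (M5 4 1)%N; rewrite ?mul1n //.
  by rewrite -[X in (_ <= X)%N]/(n + 3 * n)%N size_polyM_addn // size_polyX_muln.
- by apply: (M5 4 1)%N; rewrite ?mul1n // size_polyX_muln.
Qed.

(** [lam] is cubic in a, b and their derivatives. *)
Lemma size_lam r n F : (msize F <= n)%N -> (size (lam r F) <= 3 * n)%N.
Proof.
move=> hF.
have sy := size_restr_leq r (msize_dy hF); have sz := size_restr_leq r (msize_dz hF).
rewrite /lam; set a := restr r (dz F) in sz *; set b := _ + _ *: a.
have sb : (size b <= n)%N by apply/size_polyD_leq => //; apply: size_polyZ_leq.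
have M3 k l p q : (size p <= k * n)%N -> (size q <= l * n)%N -> (k + l = 3)%N ->
  (size (p * q)%R <= 3 * n)%N.
  by move=> h1 h2 <-; rewrite mulnDl size_polyM_addn.
have M2 p q : (size p <= n)%N -> (size q <= n)%N -> (size (p * q)%R <= 2 * n)%N.
  by move=> h1 h2; rewrite mul2n -addnn size_polyM_addn.
have d p : (size p <= n)%N -> (size p^`() <= n)%N by exact: size_deriv_leq.
apply: size_polyD_leq.
  by apply: (M3 2 1)%N; rewrite ?mul1n // size_polyD_leq ?size_polyN_leq // M2 ?d ?d.
apply/size_polyN_leq/size_polyZ_leq; apply: (M3 1 2)%N; rewrite ?mul1n ?d //.
by rewrite size_polyD_leq ?size_polyN_leq // M2 ?d.
Qed.

Lemma coefM_top p q i j : (size p <= i.+1)%N -> (size q <= j.+1)%N ->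
  (p * q)`_(i + j) = p`_i * q`_j.
Proof.
move=> hp hq; have hi : (i < (i + j).+1)%N by lia.
rewrite coefM (bigD1 (Ordinal hi)) //= addKn big1 ?addr0 // => k /eqP ne.
have [le_ki|lt_ik] := leqP k i.
  have : (k != i :> nat) by apply/eqP => e; apply: ne; apply: val_inj.
  by move=> nki; rewrite [q`__]nth_default ?mulr0 // (leq_trans hq) //; lia.
by rewrite nth_default ?mul0r // (leq_trans hp).
Qed.

(* Compare the top coefficients of p - mu q and q. *)
Lemma wronskian_eq0 n p q :
  (forall k, (0 < k < n)%N -> k%:R != 0 :> K) ->
  (size p <= n)%N -> (size q <= n)%N -> q != 0 ->
  p^`() * q = p * q^`() -> exists mu, p = mu *: q.
Proof.
move=> char sp sq q0 pq; set j := (size q).-1.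
have szq : size q = j.+1 by rewrite prednK ?size_poly_gt0.
have qj : q`_j != 0 by rewrite -[q`_j]/(lead_coef q) lead_coef_eq0.
(* This choice kills the coefficient of h in the degree of q, so a nonzero h has another degree than
   q. *)
exists (p`_j / q`_j); apply/eqP; rewrite -subr_eq0; set h := p - _.
have hj : h`_j = 0 by rewrite coefB coefZ divfK // subrr.
have sh : (size h <= n)%N by apply: size_polyD_leq => //; apply/size_polyN_leq/size_polyZ_leq.
have hq : h^`() * q = h * q^`().
  by rewrite /h derivB derivZ !mulrBl pq -!scalerAl -[q^`() * q]mulrC.
apply: contraT => h0; set i := (size h).-1.
have szh : size h = i.+1 by rewrite prednK ?size_poly_gt0.
have hi : h`_i != 0 by rewrite -[h`_i]/(lead_coef h) lead_coef_eq0.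
have ij : i != j by apply: contraNneq hi => ->; rewrite hj.
have XdE (f : {poly K}) k : ('X * f^`())`_k = k%:R * f`_k.
  by rewrite coefXM coef_deriv; case: k => [|k] //=; rewrite ?mul0r // mulr_natl.
have Xds (f : {poly K}) k : size f = k.+1 -> (size ('X * f^`())%R <= k.+1)%N.
  move=> sf; rewrite (leq_trans (size_polyMleq _ _)) // size_polyX /=.
  by have := size_poly (size f).-1 (fun k => f`_k.+1 *+ k.+1);
    rewrite -[\poly_(_ < _) _]/(f^`()) sf /=.
(* The operator X d/dX multiplies top coefficients by the degrees i and j. Comparing the two
   products gives (i - j) h_i q_j = 0, where 0 < |i - j| < n is invertible. *)
have : ('X * h^`() * q)`_(i + j) = (h * ('X * q^`()))`_(i + j).
  by rewrite -mulrA hq mulrCA.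
rewrite !coefM_top ?szq ?szh ?Xds // !XdE => /eqP; rewrite -subr_eq0.
have -> : i%:R * h`_i * q`_j - h`_i * (j%:R * q`_j) = (i%:R - j%:R) * (h`_i * q`_j) by ring.
rewrite mulf_eq0 (negPf (mulf_neq0 hi qj)) orbF.
have [lt_ij|lt_ji|/eqP] := ltngtP i j; last by rewrite (negPf ij).
  by rewrite -oppr_eq0 opprB -natrB 1?ltnW // (negPf (char _ _)) //; lia.
by rewrite -natrB 1?ltnW // (negPf (char _ _)) //; lia.
Qed.

(* The hypothesis says that (p / q)'' = 0. *)
Lemma ratio_affine n p q :
  (forall k, (0 < k <= 2 * n)%N -> k%:R != 0 :> K) ->
  (size p <= n)%N -> (size q <= n)%N -> q != 0 ->
  (p^`()^`() * q - p * q^`()^`()) * q - 2 *: (q^`() * (p^`() * q - p * q^`())) = 0 ->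
  exists kappa mu, p = (kappa *: 'X + mu%:P) * q.
Proof.
move=> char sp sq q0 E; set W := p^`() * q - p * q^`().
have n_gt0 : (0 < n)%N by rewrite (leq_trans _ sq) ?size_poly_gt0.
have sW : (size W <= 2 * n)%N.
  rewrite mul2n -addnn.
  by apply: size_polyD_leq; rewrite ?size_polyN_leq ?size_polyM_addn ?size_deriv_leq.
have sq2 : (size (q ^+ 2)%R <= 2 * n)%N by rewrite size_polyX_muln.
(* W / q^2 is the derivative of p / q, and by hypothesis its own derivative vanishes. *)
have [|//||kappa Wk] := @wronskian_eq0 (2 * n) W (q ^+ 2) _ sW sq2.
- by move=> k /andP[k0 kn]; rewrite char // k0 ltnW.
- by rewrite expf_neq0.
- have W' : W^`() = p^`()^`() * q - p * q^`()^`() by rewrite /W !derivE; ring.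
  rewrite W' expr2 derivM; apply/eqP; rewrite -subr_eq0; apply/eqP.
  by rewrite -[RHS](mul0r q) -E -/W -mul_polyC; ring.
(* Now (p - kappa X q) / q has derivative zero; the factor X raises the size bound to n + 1. *)
have [|||//||mu pm] := @wronskian_eq0 n.+1 (p - kappa *: 'X * q) q.
- by move=> k /andP[k0 kn]; rewrite char // k0 /=; lia.
- apply: size_polyD_leq; first exact: leqW.
  rewrite size_polyN -scalerAl size_polyZ_leq // (leq_trans (size_polyMleq _ _)) //.
  by rewrite size_polyX.
- exact: leqW.
- apply/eqP; rewrite -subr_eq0; apply/eqP; move: Wk; rewrite /W => Wk.
  rewrite !derivE.
  transitivity (p^`() * q - p * q^`() - kappa *: q ^+ 2); last by rewrite Wk subrr.
  rewrite -!mul_polyC; ring.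
by exists kappa, mu; rewrite mulrDl mul_polyC -pm addrC subrK.
Qed.

Lemma eq0_many_roots (V : finType) (N : {set V}) (t : V -> K) p :
  {in N &, injective t} -> (forall v, v \in N -> p.[t v] = 0) ->
  (size p <= #|N|)%N -> p = 0.
Proof.
move=> tI rN sN; apply: contraTeq sN => p0; rewrite -ltnNge cardE -(size_map t).
apply: max_poly_roots => //.
  by apply/allP => _ /mapP[v vN ->]; rewrite /root rN // -mem_enum.
by rewrite map_inj_in_uniq ?enum_uniq // => x y; rewrite !mem_enum; apply: tI.
Qed.

End DegreeBounds.

(** * Polynomials of low degree vanishing on given rays *)

Section NonsingularPolynomial.

Variable K : fieldType.
Implicit Types (F : {mpoly K[3]}) (p q : {poly K}).

Lemma nontrivial_relation (I J : finType) (f : I -> J -> K) :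
  (#|J| < #|I|)%N ->
  exists c : I -> K, (exists i, c i != 0) /\ forall j, \sum_i c i * f i j = 0.
Proof.
move=> ltJI; pose A : 'M[K]_(#|I|, #|J|) := \matrix_(i, j) f (enum_val i) (enum_val j).
have : kermx A != 0.
  rewrite kermx_eq0 /row_free; apply: contraTneq ltJI => <-.
  by rewrite -leqNgt rank_leq_col.
case/matrix0Pn=> i [k ik]; exists (fun x => kermx A i (enum_rank x)); split.
  by exists (enum_val k); rewrite enum_valK.
move=> j; have /row_matrixP/(_ i)/rowP/(_ (enum_rank j)) := mulmx_ker A.
rewrite row_mul !mxE => E; rewrite -[RHS]E (reindex (@enum_val I I)) /=;
  last exact/onW_bij/enum_val_bij.
by apply: eq_bigr => x _; rewrite !mxE enum_valK enum_rankK.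
Qed.

(** Parameter counting: there are (e + 1)^3 monomials with all exponents at most e, and each ray
    imposes 3e + 1 linear conditions, one for each coefficient of the restriction. *)
Lemma exists_vanishing (V : finType) (U : {set V}) (r : V -> K * K * K) (e : nat) :
  (#|U| * (3 * e).+1 < e.+1 ^ 3)%N ->
  exists F, [/\ F != 0, (msize F <= (3 * e).+1)%N & forall v, v \in U -> restr (r v) F = 0].
Proof.
move=> lt_c; pose I := {ffun 'I_3 -> 'I_e.+1}.
pose J := ({v : V | v \in U} * 'I_(3 * e).+1)%type.
pose mon (i : I) : 'X_{1..3} := [multinom (i j : nat) | j < 3].
have [|c [[i0 ci0] cE]] := @nontrivial_relation I J
    (fun i j => (restr (r (val j.1)) 'X_[mon i])`_j.2).
  by rewrite card_prod card_sig card_ord card_ffun !card_ord.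
pose F : {mpoly K[3]} := \sum_i c i *: 'X_[mon i].
have monI : injective mon.
  move=> i j /mnmP e_ij; apply/ffunP => k; apply: val_inj.
  by have := e_ij k; rewrite !mnmE.
have sF : (msize F <= (3 * e).+1)%N.
  apply: leq_trans (msize_sum _ _ _) _; apply/bigmax_leqP => i _.
  apply: leq_trans (msizeZ_le _ _) _; rewrite msizeX ltnS mdegE.
  have : (\sum_j mon i j <= \sum_(j < 3) e)%N.
    by apply: leq_sum => j _; rewrite mnmE -ltnS.
  by rewrite sum_nat_const card_ord.
exists F; split=> //.
  apply: contra_neq ci0 => F0; have := congr1 (mcoeff (mon i0)) F0.
  rewrite mcoeff0 raddf_sum (bigD1 i0) //= big1 => [|i ne]; rewrite mcoeffZ mcoeffX.
    by rewrite eqxx mulr1 addr0.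
  by rewrite (inj_eq monI) (negPf ne) mulr0.
move=> v vU; apply/polyP => k; rewrite [RHS]coef0.
have [lt_k|le_k] := ltnP k (3 * e).+1; last first.
  by rewrite nth_default // (leq_trans (size_restr_leq _ sF)).
apply: etrans (cE (exist _ v vU, Ordinal lt_k)); rewrite /=.
have -> : restr (r v) F = \sum_i c i *: restr (r v) 'X_[mon i].
  rewrite restr.unlock raddf_sum; apply: eq_bigr => i _.
  by rewrite /= mmapZ mul_polyC.
by rewrite coef_sum; apply: eq_bigr => i _; rewrite coefZ.
Qed.

Lemma restrC r (c : K) : restr r c%:MP = c%:P.
Proof. by rewrite restr.unlock mmapC. Qed.

(** A monomial of F with exponent m_i > 0 contributes m_i times its coefficient to the i-th partial
    derivative, and m_i < [msize F] is nonzero in K. *)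
Lemma gradient_eq0 F :
  (forall k, (0 < k < msize F)%N -> k%:R != 0 :> K) ->
  dx F = 0 -> dy F = 0 -> dz F = 0 -> exists c, F = c%:MP.
Proof.
rewrite dx.unlock dy.unlock dz.unlock => char Fx Fy Fz.
exists F@_0; apply/mpolyP => m; rewrite mcoeffC.
have [->|m0] := eqVneq m 0%MM; first by rewrite mulr1.
rewrite mulr0; apply: contraTeq isT => Fm.
have D i : mderiv i F = 0 -> m i = 0%N.
  move=> Fi; apply/eqP; rewrite -leqn0 leqNgt; apply: contraTN isT => mi.
  have mE : (m - U_(i) + U_(i))%MM = m.
    by rewrite submK //; apply/mnm_lepP => j; rewrite mnm1E; case: eqP => [<-|].
  have := mcoeff_mderiv i F (m - U_(i))%MM; rewrite Fi mcoeff0 mE mnmBE mnm1E eqxx.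
  rewrite subn1 prednK // -mulr_natr => /esym/eqP; rewrite mulf_eq0 (negPf Fm) /=.
  rewrite (negPf (char (m i) _)) // mi /=.
  apply: leq_ltn_trans (msize_mdeg_lt (_ : m \in msupp F)); last by rewrite mcoeff_msupp.
  by rewrite mdegE (bigD1 i) //= leq_addr.
case/eqP: m0; apply/mnmP => i; rewrite mnm0E.
have iE : [|| i == i0, i == i1 | i == i2] by case: i => -[|[|[|]]].
by case/or3P: iE => /eqP->; apply: D.
Qed.

(* If the gradient of F vanishes on all the rays, one of its components is a
   nonzero polynomial of smaller degree with the properties of F. *)
Lemma exists_nonsingular (V : finType) (U : {set V}) (r : V -> K * K * K) (n : nat) :
  (forall k, (0 < k <= n)%N -> k%:R != 0 :> K) -> U != set0 ->
  forall F, F != 0 -> (msize F <= n)%N -> (forall v, v \in U -> restr (r v) F = 0) ->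
  exists G, [/\ (msize G <= n)%N, (forall v, v \in U -> restr (r v) G = 0) &
    exists2 v, v \in U & exists D,
      [/\ [\/ D = dx G, D = dy G | D = dz G], (msize D <= n)%N & restr (r v) D != 0]].
Proof.
move=> char U0 F; have [s] := ubnP (msize F); elim: s F => // s IH F sF F0 Fn FU.
have [/existsP[v /andP[vU]]|] := boolP [exists v, (v \in U) &&
    [|| restr (r v) (dx F) != 0, restr (r v) (dy F) != 0 | restr (r v) (dz F) != 0]].
  move=> /or3P h; exists F; split=> //; exists v => //.
  case: h => h; [exists (dx F)|exists (dy F)|exists (dz F)]; split=> //;
    [exact: Or31|exact: msize_dx|exact: Or32|exact: msize_dy|exact: Or33|exact: msize_dz].
rewrite negb_exists => /forallP sing.
have {}sing v : v \in U -> [/\ restr (r v) (dx F) = 0, restr (r v) (dy F) = 0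
    & restr (r v) (dz F) = 0].
  by move=> vU; have := sing v; rewrite vU !negb_or !negbK => /and3P[/eqP-> /eqP-> /eqP->].
have sF0 : (0 < msize F)%N by rewrite lt0n msize_poly_eq0.
have step D : (msize D <= (msize F).-1)%N -> D != 0 ->
    (forall v, v \in U -> restr (r v) D = 0) -> exists G, [/\ (msize G <= n)%N,
      (forall v, v \in U -> restr (r v) G = 0) &
      exists2 v, v \in U & exists D,
      [/\ [\/ D = dx G, D = dy G | D = dz G], (msize D <= n)%N & restr (r v) D != 0]].
  move=> sD D0 DU; apply: (IH D) => //.
    by rewrite (leq_ltn_trans sD) // (leq_trans _ (_ : msize F <= s)%N) // ltn_predL.
  by rewrite (leq_trans sD) // (leq_trans (leq_pred _)).
have [x0|] := eqVneq (dx F) 0; last first.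
  by move=> D0; apply: (step _ _ D0) => [|v /sing[]//]; rewrite dx.unlock msize_mderiv.
have [y0|] := eqVneq (dy F) 0; last first.
  by move=> D0; apply: (step _ _ D0) => [|v /sing[]//]; rewrite dy.unlock msize_mderiv.
have [z0|] := eqVneq (dz F) 0; last first.
  by move=> D0; apply: (step _ _ D0) => [|v /sing[]//]; rewrite dz.unlock msize_mderiv.
have [|c Fc] := gradient_eq0 _ x0 y0 z0.
  by move=> k /andP[k0 kF]; rewrite char // k0 (leq_trans (ltnW kF)).
have [v vU] := set0Pn _ U0; have := FU v vU.
by rewrite Fc restrC => /eqP; rewrite polyC_eq0 => /eqP c0; rewrite Fc c0 mpolyC0 eqxx in F0.
Qed.

End NonsingularPolynomial.

(** * A ray with few crossings *)

Section CrossingRays.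

Variable K : fieldType.

Lemma leq_card_undup_map (V : finType) (N U : {set V}) (T : eqType) (f : V -> T) :
  N \subset U -> {in N &, injective f} ->
  (#|N| <= size (undup [seq f v | v <- enum U]))%N.
Proof.
move=> /fintype.subsetP NU fI; rewrite cardE -(size_map f) uniq_leq_size //.
  by rewrite map_inj_in_uniq ?enum_uniq // => x y; rewrite !mem_enum; apply: fI.
by move=> _ /mapP[v vN ->]; rewrite mem_undup map_f // mem_enum NU // -mem_enum.
Qed.

(* The coordinates u and v of the base point of the crossing ray are Moebius
   functions of t, and at most one of them is constant. *)
Lemma affine_slopes (V : finType) (N U : {set V}) (r0 : K * K * K)
    (r : V -> K * K * K) (t t' : V -> K) (kappa mu : K) (m : nat) :
  N \subset U -> r0.2 != 0 -> {in N &, injective t} ->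
  (forall x, x \in N -> meet r0 (r x) (t x) (t' x)) ->
  (forall x, x \in N -> (kappa * t x + mu) * (r0.2 - (r x).2) = 1) ->
  (size (undup [seq (r x).1.1 | x <- enum U]) <= m)%N ->
  (size (undup [seq (r x).1.2 | x <- enum U]) <= m)%N ->
  (#|N| <= m)%N.
Proof.
case: r0 => [[u0 v0] w0] /= NU w0n0 tI mt aff mu_ mv_.
(* As 1 / (w0 - w) is affine in t, solving the crossing equations for u and v gives fractional
   linear functions of t. *)
have key x : x \in N ->
   ((r x).1.1 - u0) * (w0 * (kappa * t x + mu) - 1) = - t x /\
   ((r x).1.2 - v0) * (kappa * t x + mu) = w0 * t x.
  move=> xN; have := mt x xN; have := aff x xN.
  case: (r x) => [[u v] w] /= E [e1 e2 e3].
  set q := kappa * t x + mu in E *.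
  have qw : q * w = q * w0 - 1 by rewrite -E; ring.
  have uE : u - u0 = t x - t' x by apply/(addIr (u0 + t' x));
    rewrite [in RHS]addrCA subrK e1; ring.
  have vE : v - v0 = w0 ^+ 2 * t x - w ^+ 2 * t' x.
    by apply/(addIr (v0 + w ^+ 2 * t' x)); rewrite [in RHS]addrCA subrK e3; ring.
  rewrite uE vE; split.
    have -> : w0 * q - 1 = q * w by rewrite qw; ring.
    have -> : (t x - t' x) * (q * w) = q * w * t x - q * (w * t' x) by ring.
    by rewrite -e2 -[RHS]mul1r -E; ring.
  have -> : w ^+ 2 * t' x = w * (w0 * t x) by rewrite e2; ring.
  by rewrite -[RHS]mulr1 -E; ring.
(* Up to sign, the determinants of these functions are 1 - w0 mu for u and w0 mu for v. So u
   determines t unless w0 mu = 1, in which case v does. *)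
have [w0mu|w0mu] := eqVneq (w0 * mu) 1; last first.
  apply: leq_trans mu_; apply: leq_card_undup_map NU _ => x y xN yN uxy.
  apply: tI => //; apply/eqP; rewrite -subr_eq0.
  have [kx _] := key x xN; have [ky _] := key y yN; rewrite -uxy in ky.
  set d := _ - u0 in kx ky.
  have /eqP : (t x - t y) * (d * w0 * kappa + 1) = 0.
    have -> : (t x - t y) * (d * w0 * kappa + 1) =
      (d * (w0 * (kappa * t x + mu) - 1) + t x) - (d * (w0 * (kappa * t y + mu) - 1) + t y).
      by ring.
    by rewrite kx ky !addNr subrr.
  rewrite mulf_eq0 => /orP[//|/eqP dk].
  have /eqP : d * (w0 * mu - 1) = 0.
    have -> : d * (w0 * mu - 1) = d * (w0 * (kappa * t x + mu) - 1) +
      t x - t x * (d * w0 * kappa + 1).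
      by ring.
    by rewrite kx dk mulr0 subr0 addNr.
  rewrite mulf_eq0 [w0 * mu - 1 == 0]subr_eq0 (negPf w0mu) orbF => /eqP d0.
  by move/eqP: dk; rewrite d0 !mul0r add0r oner_eq0.
have mu0 : mu != 0 by apply: contra_eq_neq w0mu => ->; rewrite mulr0 eq_sym oner_neq0.
apply: leq_trans mv_; apply: leq_card_undup_map NU _ => x y xN yN vxy.
apply: tI => //; apply/eqP; rewrite -subr_eq0.
have [_ kx] := key x xN; have [_ ky] := key y yN; rewrite -vxy in ky.
set d := _ - v0 in kx ky.
have /eqP : (t x - t y) * (w0 - d * kappa) = 0.
  have -> : (t x - t y) * (w0 - d * kappa) =
    (w0 * t x - d * (kappa * t x + mu)) - (w0 * t y - d * (kappa * t y + mu)) by ring.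
  by rewrite kx ky !subrr.
rewrite mulf_eq0 => /orP[//|/eqP dk].
have /eqP : d * mu = 0.
  have -> : d * mu = d * (kappa * t x + mu) - w0 * t x + (w0 - d * kappa) * t x by ring.
  by rewrite kx dk mul0r addr0 subrr.
rewrite mulf_eq0 (negPf mu0) orbF => /eqP d0.
by move/eqP: dk; rewrite d0 mul0r subr0 (negPf w0n0).
Qed.

(** Suppose every ray crosses more than 5n + m others, with n = 3d + 1. The bound 5n forces [psi] to
    vanish on every ray. On a ray where the gradient is not identically zero, fewer than n crossings
    are lost to zeros of F_z, and 3n of the others force [lam] = 0. Then [affine_slopes] allows only
    m crossings outside the lost ones. *)
Lemma low_degree_ray (V : finType) (U : {set V}) (e : rel V) (r : V -> K * K * K)
    (t : V -> V -> K) (d m : nat) :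
  U != set0 ->
  (forall x, x \in U -> (r x).2 != 0) ->
  (forall x y, e x y -> meet (r x) (r y) (t x y) (t y x)) ->
  (forall x y, e x y -> (r x).2 != (r y).2) ->
  (forall x y z, e x y -> e x z -> t x y = t x z -> y = z) ->
  (size (undup [seq (r x).1.1 | x <- enum U]) <= m)%N ->
  (size (undup [seq (r x).1.2 | x <- enum U]) <= m)%N ->
  (#|U| * (3 * d).+1 < d.+1 ^ 3)%N ->
  (forall k, (0 < k <= 2 * (3 * d).+1)%N -> k%:R != 0 :> K) ->
  exists2 x, x \in U & (#|[set y in U | e x y]| <= 5 * (3 * d).+1 + m)%N.
Proof.
move=> U0 w0 mt slope tI mu_ mv_ cnt char.
set n := (3 * d).+1 in cnt char *.
have [/existsP[x /andP[xU dx]]|] := boolP [exists x, (x \in U) &&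
  (#|[set y in U | e x y]| <= 5 * n + m)%N]; first by exists x.
rewrite negb_exists => /forallP large; exfalso.
have {}large x : x \in U -> (5 * n + m < #|[set y in U | e x y]|)%N.
  by move=> xU; have := large x; rewrite xU /= -ltnNge.
have [F0 [F0n0 sF0 F0U]] := exists_vanishing r cnt.
have charn k : (0 < k <= n)%N -> k%:R != 0 :> K.
  by case/andP=> k0 kn; rewrite char // k0 mulSn mul1n (leq_trans kn) ?leq_addr.
have [F [sF FU [x xU [D [gradD sD Dx]]]]] := exists_nonsingular charn U0 F0n0 sF0 F0U.
have restr_meet_eq0 y z : e y z -> z \in U -> (restr (r y) F).[t y z] = 0.
  by move=> eyz zU; rewrite (restr_meet _ (mt _ _ eyz)) FU // horner0.
have Nt y (P : pred V) : {in [set z in U | e y z & P z] &, injective (t y)}.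
  by move=> z1 z2; rewrite !inE => /and3P[_ e1 _] /and3P[_ e2 _]; apply: tI.
have NtT y : {in [set z in U | e y z] &, injective (t y)}.
  by move=> z1 z2; rewrite !inE => /andP[_ e1] /andP[_ e2]; apply: tI.
have psi0 y : y \in U -> psi (r y) F = 0.
  move=> yU; apply: (eq0_many_roots (NtT y)) => [z|]; last first.
    by rewrite (leq_trans (size_psi _ sF)) // (leq_trans _ (ltnW (large y yU))) ?leq_addr.
  rewrite inE => /andP[zU eyz]; have := slope _ _ eyz; have := mt _ _ eyz.
  have := FU y yU; have := FU z zU; case: (r y) (r z) => [[u v] w] [[u' v'] w'] /=.
  by move=> Fz Fy mtyz ne; apply: (psi_meet Fy Fz ne mtyz).
pose N := [set y in U | e x y & (restr (r x) (dz F)).[t x y] != 0].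
have Nlarge : (4 * n + m < #|N|)%N.
  pose N' := [set y in U | e x y & (restr (r x) (dz F)).[t x y] == 0].
  (* By [meet_gradient] the whole gradient vanishes at a crossing where F_z does; n such points
     would kill the component [D] on the ray. *)
  have N'n : (#|N'| < n)%N.
    rewrite ltnNge; apply: contra Dx => le_n; apply/eqP.
    apply: (eq0_many_roots (Nt x _)); last by apply: leq_trans (size_restr_leq _ sD) le_n.
    move=> y; rewrite inE => /and3P[yU exy /eqP z0].
    have := slope _ _ exy; have := mt _ _ exy; have := FU x xU; have := FU y yU.
    move: z0 gradD; case: (r x) (r y) => [[u v] w] [[u' v'] w'] /= z0 gradD Fy Fx mtxy ne.
    have [gy gx] := meet_gradient Fx Fy ne mtxy.
    by case: gradD => ->; rewrite ?gx ?gy z0 ?mulr0.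
  have := large x xU.
  have -> : [set y in U | e x y] = N :|: N'.
    by apply/setP => y; rewrite !inE; case: (y \in U) (e x y) (_ == 0) => [] [] [].
  have [+ _] := leq_card_setU N N'.
  rewrite (_ : 5 * n = 4 * n + n)%N; last by rewrite -mulSnr.
  move: N'n; move: (#|N|) (#|N'|) (#|_|) => a b c; lia.
(* At a crossing b = (w - w') a, so a / b takes the value 1 / (w - w') there. *)
pose a := restr (r x) (dz F).
pose b := restr (r x) (dy F) + (2 * (r x).2) *: a.
have bE y : y \in N -> b.[t x y] = ((r x).2 - (r y).2) * a.[t x y].
  rewrite inE => /and3P[yU exy _].
  have := slope _ _ exy; have := mt _ _ exy; have := FU x xU; have := FU y yU.
  rewrite /b /a; case: (r x) (r y) => [[u v] w] [[u' v'] w'] /= Fy Fx mtxy ne.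
  have [gy gx] := meet_gradient Fx Fy ne mtxy.
  by rewrite hornerD hornerZ gy; ring.
have lam0 : lam (r x) F = 0.
  apply: (eq0_many_roots (Nt x (fun y => (restr (r x) (dz F)).[t x y] != 0))) => [y|];
    last first.
    rewrite (leq_trans (size_lam _ sF)) // (leq_trans _ (ltnW Nlarge)) //.
    by rewrite (leq_trans _ (leq_addr _ _)) // leq_mul2r orbT.
  rewrite inE => /and3P[yU exy].
  have := slope _ _ exy; have := mt _ _ exy; have := FU x xU; have := FU y yU;
    have := psi0 y yU.
  case: (r x) (r y) => [[u v] w] [[u' v'] w'] /= psiy Fy Fx mtxy ne.
  exact: lam_meet Fx Fy ne mtxy psiy.
have [y0 y0N] : exists y, y \in N.
  by apply/set0Pn; rewrite -card_gt0 (leq_ltn_trans _ Nlarge).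
have b0 : b != 0.
  apply: contraTneq y0N => b0; have := bE y0; rewrite b0 horner0 inE => bE0.
  apply/negP => y0N; have := y0N; have := bE0 y0N => /esym/eqP.
  rewrite mulf_eq0 => /orP[|/eqP a0]; last by case/and3P: y0N => _ _; rewrite -/a a0 eqxx.
  by rewrite subr_eq0 => /eqP sl /and3P[_ /slope]; rewrite sl eqxx.
have sa : (size a <= n)%N by apply/size_restr_leq/msize_dz.
have sb : (size b <= n)%N.
  by apply: size_polyD_leq; [apply/size_restr_leq/msize_dy|apply: size_polyZ_leq].
have [kappa [mu ab]] := ratio_affine char sa sb b0 lam0.
suff : (#|N| <= m)%N by rewrite leqNgt (leq_trans _ Nlarge) // ltnS leq_addl.
apply: (@affine_slopes _ N U (r x) r (t x) (fun y => t y x) kappa mu) => //.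
- by apply/fintype.subsetP => y; rewrite inE => /andP[].
- exact: w0.
- exact: Nt.
- by move=> y; rewrite inE => /and3P[_ /mt].
move=> y yN; have := bE y yN; have : a.[t x y] != 0 by move: yN; rewrite inE => /and3P[].
move=> ay /(congr1 (fun z => (kappa * t x y + mu) * z)).
have -> : (kappa * t x y + mu) * b.[t x y] = a.[t x y].
  by rewrite [in RHS]ab hornerM; congr (_ * _); rewrite hornerD hornerZ hornerX hornerC.
by move=> E; apply: (mulIf ay); rewrite mul1r [in RHS]E; ring.
Qed.

End CrossingRays.

End NullRays.

Import NullRays.

(** * Collisions of x (s - b) *)

(** Deleting a vertex with at most D neighbours removes at most 2D ordered pairs; induct on the
    number of vertices. *)
Lemma degenerate_edges (V : finType) (e : rel V) (D : nat) (U : {set V}) :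
  symmetric e ->
  (forall W : {set V}, W \subset U -> W != set0 ->
     exists2 x, x \in W & (#|[set y in W | e x y]| <= D)%N) ->
  (#|[set q : V * V | [&& q.1 \in U, q.2 \in U & e q.1 q.2]]| <= 2 * D * #|U|)%N.
Proof.
move=> esym; have [n] := ubnP #|U|; elim: n U => // n IH U ltUn degU.
have [->|U0] := eqVneq U set0.
  by rewrite cards0 muln0 leqn0 cards_eq0; apply/eqP/setP => q; rewrite !inE.
have [x xU xD] := degU U (fintype.subxx _) U0.
have UE : (#|U :\ x| < n)%N by have := cardsD1 x U; rewrite xU; lia.
have := IH _ UE (fun W WU => degU W (fintype.subset_trans WU (subsetDl _ _))).
set E' := [set q | _] => leE'; set E := [set q | _].
pose Nx := [set y in U | e x y].
have sub : E \subset E' :|: ([set (x, y) | y in Nx] :|: [set (y, x) | y in Nx]).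
  apply/fintype.subsetP => -[y z]; rewrite !inE /= => /and3P[yU zU eyz].
  have [yx|yx] := eqVneq y x.
    by apply/orP; right; apply/orP; left; apply/imsetP; exists z; rewrite ?inE -?yx ?zU.
  have [zx|zx] := eqVneq z x; last by rewrite yU zU eyz.
  apply/orP; right; apply/orP; right; apply/imsetP; exists y; rewrite ?inE -?zx ?yU //.
  by rewrite esym.
rewrite (cardsD1 x U) xU addnC mulnDr muln1.
apply: leq_trans (subset_leq_card sub) _; apply: leq_trans (leq_card_setU _ _).1 _.
apply: leq_add => //; apply: leq_trans (leq_card_setU _ _).1 _.
by rewrite mul2n -addnn leq_add // (leq_trans (leq_imset_card _ _)).
Qed.

(** The common value 0 is excluded, since s = b and s' = b' would leave x and x' free. *)
Definition collisions (F : finFieldType) (S B X : {set F}) : nat :=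
  #|[set q : (F * F * F) * (F * F * F) |
      let: ((s, b, x), (s', b', x')) := q in
      [&& s \in S, b \in B, x \in X, s' \in S, b' \in B, x' \in X,
          x * (s - b) == x' * (s' - b') & x * (s - b) != 0]]|.

(** * Collisions as crossings of two families of rays *)

Section Collisions.

Variables (F : finFieldType) (K : fieldType) (emb : {rmorphism F -> K}) (eps : K).
Hypothesis eps_neq0 : eps != 0.
Hypothesis eps_indep : forall a b, emb a = eps * emb b -> a = 0 /\ b = 0.

(* The family [false] consists of the (b, s', x), and [true] of the (s, b', x');
   two such rays cross away from their base points iff x (s - b) = x' (s' - b')
   is nonzero. *)
Definition base_ray (v : bool * (F * F * F)) : K * K * K :=
  let: (i, (a, b, x)) := v in
  (emb a, emb b / eps, if i then (eps * emb x)^-1 else emb x).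

Definition adj (v v' : F * F * F) : bool :=
  let: (b, s', x) := v in let: (s, b', x') := v' in
  (x * (s - b) == x' * (s' - b')) && (x * (s - b) != 0).

Definition adjacent (v v' : bool * (F * F * F)) : bool :=
  match v.1, v'.1 with
  | false, true => adj v.2 v'.2
  | true, false => adj v'.2 v.2
  | _, _ => false
  end.

(** The parameter of the crossing on the first ray, for rays of opposite families: it solves u + t =
    u' + t' and w t = w' t' for the slopes x and 1 / (eps x'). *)
Definition position (v v' : bool * (F * F * F)) : K :=
  let: (i, (a, b, x)) := v in let: (_, (a', b', x')) := v' in
  if i then eps * emb (x * x') * emb (a - a') / (1 - eps * emb (x * x'))
  else emb (a' - a) / (1 - eps * emb (x * x')).

Lemma adjacent_sym : symmetric adjacent.
Proof. by case=> [[] v] [[] v']. Qed.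

Lemma eps_denom a : 1 - eps * emb a != 0.
Proof.
rewrite subr_eq0; apply/eqP => E.
have [] := @eps_indep 1 a; first by rewrite rmorph1 E.
by move/eqP; rewrite oner_eq0.
Qed.

(** The first two crossing equations hold by the choice of [position]; given these, the third one
    reduces to x (s - b) = x' (s' - b'). *)
Lemma adj_meet b s' x s b' x' : adj (b, s', x) (s, b', x') ->
  meet (base_ray (false, (b, s', x))) (base_ray (true, (s, b', x')))
    (position (false, (b, s', x)) (true, (s, b', x')))
    (position (true, (s, b', x')) (false, (b, s', x))).
Proof.
rewrite /adj => /andP[/eqP E ne] /=.
have x0 : emb x != 0 by rewrite fmorph_eq0; apply: contraNneq ne => ->; rewrite mul0r.
have x'0 : emb x' != 0.
  by rewrite fmorph_eq0; apply: contraNneq ne => x'0; rewrite E x'0 mul0r.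
have e0 := eps_neq0; have := eps_denom (x * x'); rewrite rmorphM /=.
have /(congr1 emb) := E; rewrite [x' * x]mulrC !(rmorphM, rmorphB) /=.
move: (emb x) (emb x') (emb s) (emb b) (emb s') (emb b') x0 x'0 => X X' S B S' B' X0 X'0 EE D0.
split.
- by field.
- by field; rewrite D0 X'0 e0.
have -> : S' = B' + X * (S - B) / X' by rewrite EE; field.
by field; rewrite X'0 e0 D0.
Qed.

Lemma adjacent_meet v v' : adjacent v v' ->
  meet (base_ray v) (base_ray v') (position v v') (position v' v).
Proof.
case: v v' => [[] [[a b] x]] [[] [[a' b'] x']] //.
  by move=> h; apply/meet_sym/adj_meet.
exact: adj_meet.
Qed.

(** Equal slopes would mean eps x x' = 1, against the independence of 1 and eps. *)
Lemma adjacent_slope v v' : adjacent v v' -> (base_ray v).2 != (base_ray v').2.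
Proof.
have key b s' x s b' x' : adj (b, s', x) (s, b', x') -> emb x != (eps * emb x')^-1.
  rewrite /adj => /andP[/eqP E ne]; apply/eqP => xE.
  have x'0 : emb x' != 0.
    by rewrite fmorph_eq0; apply: contraNneq ne => x'0; rewrite E x'0 mul0r.
  have [] := @eps_indep 1 (x * x'); last by move/eqP; rewrite oner_eq0.
  by rewrite rmorphM /= xE rmorph1; field; rewrite x'0 eps_neq0.
case: v v' => [[] [[a b] x]] [[] [[a' b'] x']] //= h; last exact: key h.
by rewrite eq_sym; apply: key h.
Qed.

(* The generic parameter eps prevents two rays of one family from meeting away
   from their base points, so distinct neighbours are met at distinct points. *)
Lemma position_inj v v1 v2 : adjacent v v1 -> adjacent v v2 ->
  position v v1 = position v v2 -> v1 = v2.
Proof.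
case: v v1 v2 => [i [[a b] x]] [i1 [[a1 b1] x1]] [i2 [[a2 b2] x2]].
rewrite /adjacent /=; case: i i1 i2 => [] [] [] //=.
- move=> /andP[/eqP E1 n1] /andP[/eqP E2 n2].
  have D1 := eps_denom (x * x1); have D2 := eps_denom (x * x2).
  have x10 : x1 != 0 by apply: contraNneq n1 => ->; rewrite mul0r.
  have x20 : x2 != 0 by apply: contraNneq n2 => ->; rewrite mul0r.
  have x0 : x != 0 by apply: contraNneq n1 => x0; rewrite E1 x0 mul0r.
  move/eqP; rewrite eqr_div // => /eqP E.
  have {}E : emb (x1 * (a - a1) - x2 * (a - a2)) =
    eps * emb (x * (x1 * x2 * ((a - a1) - (a - a2)))).
    have /mulfI : eps * emb x != 0 by rewrite mulf_neq0 ?fmorph_eq0 ?eps_neq0.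
    apply; rewrite !(rmorphB, rmorphM) /= in E *.
    move: E; move: (emb x) (emb x1) (emb x2) (emb a) (emb a1) (emb a2) => X X1 X2 A A1 A2 E.
    transitivity (eps * (X * X1) * (A - A1) * (1 - eps * (X * X2)) - eps * (X * X2) * (A -
      A2) * (1 - eps * (X * X1)) +
        eps * X * (eps * (X * (X1 * X2 * (A - A1 - (A - A2)))))); first by ring.
    by rewrite E subrr add0r.
  (* The part linear in eps gives a1 = a2, then the part free of eps gives x1 = x2, and the
     collision equations give b1 = b2. *)
  have [/subr0_eq E3 /eqP] := eps_indep E.
  rewrite !mulf_eq0 (negPf x0) (negPf x10) (negPf x20) /= => /eqP/subr0_eq E4.
  have aE : a1 = a2 by apply: oppr_inj; apply: (addrI a).
  have d0 : a - a1 != 0 by apply: contraNneq n1 => ->; rewrite mulr0.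
  have xE : x1 = x2 by apply: (mulIf d0); rewrite E3 E4.
  congr (_, (_, _, _)) => //; apply/(addIr (- b))/(mulfI x0).
  by rewrite -E1 -E2 xE aE.
- move=> /andP[/eqP E1 n1] /andP[/eqP E2 n2].
  have D1 := eps_denom (x * x1); have D2 := eps_denom (x * x2).
  have x0 : x != 0 by apply: contraNneq n1 => ->; rewrite mul0r.
  have x10 : x1 != 0 by apply: contraNneq n1 => x10; rewrite E1 x10 mul0r.
  have x20 : x2 != 0 by apply: contraNneq n2 => x20; rewrite E2 x20 mul0r.
  move/eqP; rewrite eqr_div // => /eqP E.
  have {}E : emb ((a1 - a) - (a2 - a)) = eps * emb (x * ((a1 - a) * x2 - (a2 - a) * x1)).
    rewrite !(rmorphB, rmorphM) /= in E *.
    move: E; move: (emb x) (emb x1) (emb x2) (emb a) (emb a1) (emb a2) => X X1 X2 A A1 A2 E.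
    transitivity ((A1 - A) * (1 - eps * (X * X2)) - (A2 - A) * (1 - eps * (X * X1)) +
      eps * (X * ((A1 - A) * X2 - (A2 - A) * X1))); first by ring.
    by rewrite E subrr add0r.
  have [/subr0_eq/addIr aE /eqP] := eps_indep E.
  rewrite mulf_eq0 (negPf x0) /= => /eqP/subr0_eq E4.
  have d0 : a1 - a != 0 by apply: contraNneq n1 => ->; rewrite mulr0.
  have xE : x1 = x2 by apply: (mulfI d0); rewrite E4 aE.
  congr (_, (_, _, _)) => //; apply/oppr_inj/(addrI b); apply: (mulfI x10).
  by rewrite -E1 xE -E2 aE.
Qed.

(** The two families contain at most 2N rays with x nonzero, N = |S||B||X|, and their base
    coordinates come from S and B. By [low_degree_ray] every nonempty subfamily has a ray of low
    degree, so [degenerate_edges] bounds the crossings. *)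
Lemma collisions_small_ext (S B X : {set F}) (d : nat) :
  (6 * (#|S| * #|B| * #|X|) <= d.+1 ^ 2)%N ->
  (forall k, (0 < k <= 2 * (3 * d).+1)%N -> k%:R != 0 :> F) ->
  (collisions S B X <=
    4 * (#|S| * #|B| * #|X|) * (5 * (3 * d).+1 + (#|S| + #|B|)))%N.
Proof.
move=> dN char; set N := (#|S| * #|B| * #|X|)%N in dN *.
pose X' := X :\ 0.
pose U : {set bool * (F * F * F)} :=
  [set (false, q) | q in setX (setX B S) X'] :|: [set (true, q) | q in setX (setX S B) X'].
have memU i a b x : ((i, (a, b, x)) \in U) =
    [&& x != 0, x \in X & if i then (a \in S) && (b \in B) else (a \in B) && (b \in S)].
  rewrite inE; apply/orP/idP.
    case=> /imsetP[[[a' b'] x']]; rewrite !inE /= => h [-> -> -> ->].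
      by case/andP: h => /andP[-> ->] /andP[-> ->].
    by case/andP: h => /andP[-> ->] /andP[-> ->].
  case: i => /and3P[x0 xX /andP[h1 h2]]; [right|left]; apply/imsetP; exists (a, b, x) => //;
    by rewrite !inE /= h1 h2 x0 xX.
have cardU : (#|U| <= 2 * N)%N.
  apply: leq_trans (leq_card_setU _ _).1 _; rewrite mul2n -addnn /N.
  have X'X : (#|X'| <= #|X|)%N by rewrite subset_leq_card // subsetDl.
  by rewrite leq_add // (leq_trans (leq_imset_card _ _)) // !cardsX ?[(#|B| * _)%N]mulnC
    leq_mul.
have sub : (collisions S B X <= #|[set q | [&& q.1 \in U, q.2 \in U & adjacent q.1 q.2]]|)%N.
  pose f (q : (F * F * F) * (F * F * F)) :=
    let: ((s, b, x), (s', b', x')) := q in ((false, (b, s', x)), (true, (s, b', x'))).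
  have fI : injective f by move=> [[[s b] x] [[s' b'] x']] [[[t c] y] [[t' c'] y']] [-> ->
    -> -> -> ->].
  rewrite /collisions -(card_imset _ fI) subset_leq_card //.
  apply/fintype.subsetP => _ /imsetP[[[[s b] x] [[s' b'] x']] + ->].
  rewrite inE => /and5P[sS bB xX s'S /and4P[b'B x'X /eqP E n]];
    rewrite inE /= !memU sS bB xX s'S b'B x'X /=.
  rewrite /adjacent /= E eqxx -E n !andbT.
  apply/andP; split; first by apply: contraNneq n => ->; rewrite mul0r.
  by apply: contraNneq n => x'0; rewrite E x'0 mul0r.
apply: leq_trans sub _; set D := (5 * _ + _)%N.
apply: (@leq_trans (2 * D * #|U|)%N); last first.
  have -> : (4 * N * D = 2 * D * (2 * N))%N by ring.
  by rewrite leq_mul2l cardU orbT.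
apply: degenerate_edges adjacent_sym _ => W WU W0.
have WUP := fintype.subsetP WU.
have D2 (f : bool * (F * F * F) -> K) (g : F -> K) :
    (forall v, v \in W -> exists2 z, z \in S :|: B & f v = g z) ->
    (size (undup [seq f v | v <- enum W]) <= #|S| + #|B|)%N.
  move=> fg; apply: leq_trans (leq_card_setU S B).1.
  rewrite [#|_|]cardE -(size_map g) uniq_leq_size ?undup_uniq //.
  move=> k; rewrite mem_undup => /mapP[v]; rewrite mem_enum => /fg[z zSB fv] ->.
  by rewrite fv map_f // mem_enum.
apply: (@low_degree_ray _ _ W adjacent base_ray position d (#|S| + #|B|)) => //.
- move=> [i [[a b] x]] /WUP; rewrite memU /= => /and3P[x0 _ _].
  by case: (i); rewrite ?invr_eq0 ?mulf_neq0 ?fmorph_eq0 ?eps_neq0.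
- exact: adjacent_meet.
- exact: adjacent_slope.
- exact: position_inj.
- apply: (D2 _ emb) => -[i [[a b] x]] /WUP; rewrite memU /= => /and3P[_ _ h].
  by exists a => //; rewrite inE; case: (i) h => /andP[-> _]; rewrite ?orbT.
- apply: (D2 _ (fun z => emb z / eps)) => -[i [[a b] x]] /WUP; rewrite memU /= => /and3P[_ _ h].
  by exists b => //; rewrite inE; case: (i) h => /andP[_ ->]; rewrite ?orbT.
- have W_gt0 : (0 < #|W|)%N by rewrite card_gt0.
  have WN : (#|W| <= 2 * N)%N by apply: leq_trans (subset_leq_card WU) _.
  (* By the hypothesis on d, 2N (3d + 1) < 6N (d + 1) <= (d + 1)^3. *)
  apply: (@leq_ltn_trans (2 * N * (3 * d).+1)); first by rewrite leq_mul2r WN orbT.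
  have N_gt0 : (0 < N)%N by move: W_gt0 WN; case: (N) => //; case: (#|W|).
  by move: dN N_gt0; rewrite !expnS expn0 !muln1; move: (N) => k; nia.
- by move=> k hk; rewrite -(rmorph_nat emb) fmorph_eq0 char.
Qed.

End Collisions.

(** The extension is the field of rational functions over F, with the indeterminate as eps. *)
Lemma collisions_small (F : finFieldType) (S B X : {set F}) (d : nat) :
  (6 * (#|S| * #|B| * #|X|) <= d.+1 ^ 2)%N ->
  (forall k, (0 < k <= 2 * (3 * d).+1)%N -> k%:R != 0 :> F) ->
  (collisions S B X <=
    4 * (#|S| * #|B| * #|X|) * (5 * (3 * d).+1 + (#|S| + #|B|)))%N.
Proof.
pose emb : {rmorphism F -> {fraction {poly F}}} := (@tofrac _ \o @polyC F).
apply: (@collisions_small_ext F _ emb (tofrac 'X)).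
  by rewrite tofrac_eq0 polyX_eq0.
move=> a b; rewrite /= -rmorphM => /eqP; rewrite tofrac_eq => /eqP ab.
have := congr1 (fun p : {poly F} => p`_1) ab; have := congr1 (fun p : {poly F} => p`_0) ab.
by rewrite /= !coefXM !coefC /= => -> <-.
Qed.

(** * Incidences of points and planes, and collisions of large sets *)

Section Incidences.

Variables (F : finFieldType) (R : realFieldType).
Local Notation p := #|F|.

(** The triple (s, y, c) stands for a plane with normal vector (s, -1, -y). *)
Definition incident (h q : F * F * F) : bool :=
  let: (s, y, c) := h in let: (q1, q2, q3) := q in s * q1 - q2 == y * q3 - c.

Lemma incidentE s y c q1 q2 q3 :
  incident (s, y, c) (q1, q2, q3) = (c == y * q3 - s * q1 + q2).
Proof.
rewrite /incident eq_sym subr_eq -[c == _]subr_eq0 -[y * q3 == _]subr_eq0.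
by rewrite -oppr_eq0; congr (_ == _); ring.
Qed.

Lemma card_planes q : #|[set h | incident h q]| = (p ^ 2)%N.
Proof.
case: q => [[q1 q2] q3].
have -> : [set h | incident h (q1, q2, q3)] =
    [set (z.1, z.2, z.2 * q3 - z.1 * q1 + q2) | z in [set: F * F]].
  apply/setP => -[[s y] c]; rewrite inE incidentE; apply/eqP/imsetP.
    by move=> ->; exists (s, y).
  by case=> -[s' y'] _ [-> -> ->].
rewrite card_imset ?cardsT ?card_prod ?expnS ?expn0 ?muln1 //.
by move=> [s y] [s' y'] [-> ->].
Qed.

(** Subtracting the two incidences leaves an affine equation in s and y, which is unsolvable if the
    points differ only in the second coordinate; c is then determined. *)
Lemma card_planes2 q q' : q != q' -> (#|[set h | incident h q && incident h q']| <= p)%N.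
Proof.
case: q q' => [[q1 q2] q3] [[q1' q2'] q3'] ne.
set H := [set h | _].
have sub (f : F -> F * F * F) : (forall h, h \in H -> exists z, h = f z) -> (#|H| <= p)%N.
  move=> Hf; apply: (@leq_trans #|[set f z | z in [set: F]]|).
    by apply/subset_leq_card/fintype.subsetP => h /Hf[z ->]; rewrite imset_f ?inE.
  by rewrite (leq_trans (leq_imset_card _ _)) // cardsT.
have [e3|n3] := eqVneq q3 q3'; last first.
  have d3 : q3 - q3' != 0 by rewrite subr_eq0.
  pose y s := (s * (q1 - q1') - (q2 - q2')) / (q3 - q3').
  apply: (sub (fun s => (s, y s, y s * q3 - s * q1 + q2))) => -[[s y0] c].
  rewrite inE !incidentE => /andP[/eqP -> /eqP E]; exists s; rewrite /y.
  suff -> : (s * (q1 - q1') - (q2 - q2')) / (q3 - q3') = y0 by [].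
  apply: (mulIf d3); rewrite divfK //.
  by apply/subr0_eq; rewrite -[RHS](subrr (y0 * q3' - s * q1' + q2')) -{2}E; ring.
have [e1|n1] := eqVneq q1 q1'; last first.
  have d1 : q1 - q1' != 0 by rewrite subr_eq0.
  pose s := (q2 - q2') / (q1 - q1').
  apply: (sub (fun y => (s, y, y * q3 - s * q1 + q2))) => -[[s0 y] c].
  rewrite inE !incidentE -e3 => /andP[/eqP -> /eqP E]; exists y.
  suff -> : s = s0 by [].
  apply: (mulIf d1); rewrite divfK //.
  by apply/subr0_eq; rewrite -[RHS](subrr (y * q3 - s0 * q1' + q2')) -{1}E; ring.
suff -> : H = set0 by rewrite cards0.
apply/setP => -[[s y] c]; rewrite !inE !incidentE -e3 -e1; apply/negbTE/negP.
case/andP=> /eqP -> /eqP/addrI e2; case/eqP: ne.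
by rewrite e3 e1 e2.
Qed.

(** Second moment method: the number of points of P on a plane has mean |P| / p, and since two
    distinct points share at most p planes, its squared deviations sum to at most |P| p^2. *)
Lemma incidence_bound (P H : {set F * F * F}) (N : nat) :
  (#|P| <= N)%N -> (#|H| <= N)%N ->
  (#|[set z | [&& z.1 \in P, z.2 \in H & incident z.2 z.1]]|)%:R <=
    N%:R ^+ 2 / p%:R + p%:R * N%:R :> R.
Proof.
move=> PN HN.
have p_gt0 : 0 < p%:R :> R by rewrite ltr0n; apply/card_gt0P; exists 0.
pose f h : R := \sum_(q in P) (incident h q)%:R.
have f1 : \sum_h f h = #|P|%:R * p%:R ^+ 2.
  rewrite exchange_big /= (eq_bigr (fun=> p%:R ^+ 2)) => [|q _].
    by rewrite sumr_const mulr_natl.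
  rewrite -natr_sum -natrX; congr (_%:R);
    rewrite -(card_planes q) -sum1dep_card [RHS]big_mkcond.
  by apply: eq_bigr => h _; case: (incident h q).
have f2 : \sum_h f h ^+ 2 <= #|P|%:R * p%:R ^+ 2 + #|P|%:R ^+ 2 * p%:R.
  have -> : \sum_h f h ^+ 2 =
    \sum_(q in P) \sum_(q' in P) #|[set h | incident h q && incident h q']|%:R.
    under eq_bigr => h _ do rewrite expr2 big_distrlr /=.
    rewrite exchange_big; apply: eq_bigr => q _; rewrite exchange_big; apply: eq_bigr => q' _.
    rewrite -sum1dep_card natr_sum [RHS]big_mkcond /=; apply: eq_bigr => h _.
    by case: (incident h q) (incident h q') => [] []; rewrite ?mulr1 ?mulr0.
  have -> : #|P|%:R * p%:R ^+ 2 + #|P|%:R ^+ 2 * p%:R =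
      \sum_(q in P) \sum_(q' in P) ((q == q')%:R * p%:R ^+ 2 + p%:R) :> R.
    rewrite (eq_bigr (fun=> p%:R ^+ 2 + #|P|%:R * p%:R)) => [|q qP].
      by rewrite sumr_const -mulr_natl; ring.
    rewrite big_split /= sumr_const; congr (_ + _); last by rewrite mulr_natl.
    rewrite (bigD1 q) //= eqxx mul1r big1 ?addr0 // => q' /andP[_].
    by rewrite eq_sym => /negPf->; rewrite mul0r.
  apply: ler_sum => q _; apply: ler_sum => q' _; have [<-|ne] := eqVneq q q'.
    have -> : [set h | incident h q && incident h q] = [set h | incident h q].
      by apply/setP => h; rewrite !inE andbb.
    by rewrite card_planes natrX mul1r lerDl ltW.
  by rewrite mul0r add0r ler_nat card_planes2.
pose mu : R := #|P|%:R / p%:R.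
have var : \sum_h (f h - mu) ^+ 2 <= #|P|%:R * p%:R ^+ 2.
  under eq_bigr => h _ do rewrite sqrrB.
  rewrite big_split sumrB /= sumr_const (_ : \sum_i f i * mu *+ 2 = 2 * mu * \sum_i f i);
    last first.
    by rewrite mulr_sumr; apply: eq_bigr => h _; ring.
  have -> : #|{: F * F * F}| = (p ^ 3)%N by rewrite !card_prod !expnS expn0; ring.
  rewrite f1 -(mulr_natl (mu ^+ 2)) natrX.
  have -> : p%:R ^+ 3 * mu ^+ 2 = #|P|%:R ^+ 2 * p%:R :> R by rewrite /mu; field;
    rewrite gt_eqF.
  have -> : 2 * mu * (#|P|%:R * p%:R ^+ 2) = 2 * #|P|%:R ^+ 2 * p%:R :> R by rewrite /mu;
    field; rewrite gt_eqF.
  by move: f2; set a := \sum_h _; lra.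
have -> : (#|[set z | [&& z.1 \in P, z.2 \in H & incident z.2 z.1]]|)%:R = \sum_(h in H) f h.
  rewrite exchange_big /= -sum1dep_card natr_sum pair_big_dep /= big_mkcond [RHS]big_mkcond.
  by apply: eq_bigr => -[q h] _ /=; case: (q \in P) (h \in H) (incident h q) => [] [] [].
(* The difference of the two sides at h is the square (f h - mu - p)^2 / (2p). *)
have step : \sum_(h in H) f h <= \sum_(h in H) mu +
  \sum_(h in H) ((f h - mu) ^+ 2 / (2 * p%:R) + p%:R / 2).
  rewrite -big_split /=; apply: ler_sum => h _; rewrite -lerBlDl.
  rewrite -subr_ge0 (_ : _ - _ = (f h - mu - p%:R) ^+ 2 / (2 * p%:R)); last by field;
    rewrite gt_eqF.
  by rewrite divr_ge0 ?sqr_ge0 // mulr_ge0 // ltW.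
apply: le_trans step _;
  rewrite big_split /= !sumr_const -(mulr_natl mu) -(mulr_natl (p%:R / 2)).
have PR : #|P|%:R <= N%:R :> R by rewrite ler_nat.
have HR : #|H|%:R <= N%:R :> R by rewrite ler_nat.
have h1 : #|H|%:R * mu <= N%:R ^+ 2 / p%:R.
  by rewrite /mu mulrA ler_pM2r ?invr_gt0 // expr2 ler_pM.
have h2 : \sum_(h in H) (f h - mu) ^+ 2 / (2 * p%:R) <= p%:R / 2 * N%:R.
  rewrite -mulr_suml ler_pdivrMr ?mulr_gt0 //.
  have -> : p%:R / 2 * N%:R * (2 * p%:R) = N%:R * p%:R ^+ 2 :> R by field.
  apply: (@le_trans _ _ (\sum_h (f h - mu) ^+ 2)).
    by rewrite [leRHS](bigID (mem H)) /= lerDl sumr_ge0 // => h _; apply: sqr_ge0.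
  by apply: le_trans var _; rewrite ler_wpM2r // exprn_ge0 // ltW.
have h3 : #|H|%:R * (p%:R / 2) <= p%:R / 2 * N%:R :> R.
  by rewrite mulrC ler_wpM2l // divr_ge0 // ltW.
lra.
Qed.

(** A collision is an incidence of the point (x, x b, s') with the plane (s, x', x' b'); as x and x'
    are nonzero, it is recovered from them. *)
Lemma collisions_large (S B X : {set F}) (N : nat) :
  N = (#|S| * #|B| * #|X|)%N ->
  (collisions S B X)%:R <= N%:R ^+ 2 / p%:R + p%:R * N%:R :> R.
Proof.
move=> NE; pose X' := X :\ 0.
pose P := [set (z.2, z.2 * z.1.2, z.1.1) | z in setX (setX S B) X'].
pose H := [set (z.1.1, z.2, z.2 * z.1.2) | z in setX (setX S B) X'].
have le_N (T : finType) (f : F * F * F -> T) : (#|f @: setX (setX S B) X'| <= N)%N.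
  rewrite (leq_trans (leq_imset_card _ _)) // !cardsX NE leq_mul2l.
  by rewrite subset_leq_card ?orbT // subsetDl.
apply: le_trans (incidence_bound (le_N _ _ : #|P| <= N)%N (le_N _ _ : #|H| <= N)%N).
rewrite ler_nat.
pose f (q : (F * F * F) * (F * F * F)) :=
  let: ((s, b, x), (s', b', x')) := q in ((x, x * b, s'), (s, x', x' * b')).
pose Q := [set q : (F * F * F) * (F * F * F) |
      let: ((s, b, x), (s', b', x')) := q in
      [&& s \in S, b \in B, x \in X, s' \in S, b' \in B, x' \in X,
          x * (s - b) == x' * (s' - b') & x * (s - b) != 0]].
have neq0 s b x s' b' x' : ((s, b, x), (s', b', x')) \in Q -> x != 0 /\ x' != 0.
  rewrite inE => /and5P[_ _ _ _ /and4P[_ _ /eqP E n]].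
  split; first by apply: contraNneq n => ->; rewrite mul0r.
  by apply: contraNneq n => x'0; rewrite E x'0 mul0r.
rewrite -[collisions S B X]/#|Q| -(@card_in_imset _ _ f); last first.
  move=> [[[s b] x] [[s' b'] x']] [[[t c] y] [[t' c'] y']] /neq0[x0 x'0] _ [<- + <- <- <-].
  by move=> /(mulfI x0) <- /(mulfI x'0) <-.
apply/subset_leq_card/fintype.subsetP => _ /imsetP[[[[s b] x] [[s' b'] x']] qQ ->].
have [x0 x'0] := neq0 _ _ _ _ _ _ qQ.
move: qQ; rewrite !inE => /and5P[sS bB xX s'S /and4P[b'B x'X /eqP E _]].
apply/and3P; split.
- by apply/imsetP; exists (s', b, x); rewrite ?inE //= s'S bB x0.
- by apply/imsetP; exists (s, b', x'); rewrite ?inE //= sS b'B x'0.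
by rewrite /=; apply/eqP; move: E; rewrite !mulrBr => <-; rewrite mulrC.
Qed.

End Incidences.

(** If p^2 <= 289 N, the term p N of [collisions_large] is at most 289 N^2 / p. Otherwise the
    degrees in [collisions_small] stay below the characteristic. *)
Lemma collisions_bound (R : rcfType) (p : nat) (S B X : {set 'F_p}) (N : R) :
  prime p -> N = (#|S| * #|B| * #|X|)%:R ->
  (collisions S B X)%:R <= 290 * (N ^+ 2 / p%:R)
    + 4 * N * (45 * Num.sqrt N + #|S|%:R + #|B|%:R).
Proof.
move=> pr; set n := (#|S| * #|B| * #|X|)%N => NE.
have p_gt0 : 0 < p%:R :> R by rewrite ltr0n prime_gt0.
have N0 : 0 <= N by rewrite NE ler0n.
have [le_p2|lt_p2] := leqP (p ^ 2) (289 * n).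
  have := collisions_large R (erefl n); rewrite card_Fp // -NE => /le_trans; apply.
  have h1 : p%:R * N <= 289 * (N ^+ 2 / p%:R).
    rewrite mulrA ler_pdivlMr // (_ : p%:R * N * p%:R = p%:R ^+ 2 * N); last by ring.
    rewrite (_ : 289 * N ^+ 2 = 289 * N * N); last by ring.
    by rewrite ler_wpM2r // NE -natrX -natrM ler_nat.
  have h2 : 0 <= 4 * N * (45 * Num.sqrt N + #|S|%:R + #|B|%:R).
    by rewrite mulr_ge0 ?mulr_ge0 // !addr_ge0 ?mulr_ge0 ?sqrtr_ge0.
  lra.
have n_le : 0 <= 290 * (N ^+ 2 / p%:R) by rewrite mulr_ge0 // divr_ge0 ?sqr_ge0 // ltW.
rewrite -[leLHS]add0r lerD //.
have [n0|n_gt0] := posnP n.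
  have := collisions_large R (erefl n); rewrite -NE NE n0 expr0n mul0r !mulr0 addr0 mul0r;
    apply.
have ex_d : exists d, (6 * n <= d.+1 ^ 2)%N.
  by exists (6 * n)%N; rewrite -mulnn; nia.
(* Minimality of d gives d^2 <= 6n, hence (6d + 2)^2 <= 280 n < p^2. *)
case: (ex_minnP ex_d) => d dn dmin.
have d2 : (d ^ 2 <= 6 * n)%N.
  case: d dmin {dn} => // d dmin; rewrite leqNgt; apply/negP => lt_d.
  by have := dmin d (ltnW lt_d); rewrite ltnn.
have dp : (2 * (3 * d).+1 < p)%N.
  rewrite -(ltn_exp2r _ _ (isT : 0 < 2)%N) (leq_ltn_trans _ lt_p2) //.
  have : (2 * d <= 5 * n)%N by rewrite -(leq_exp2r _ _ (isT : 0 < 2)%N) !expnMn; nia.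
  have -> : ((2 * (3 * d).+1) ^ 2 = 36 * d ^ 2 + 24 * d + 4)%N by rewrite -addn1; ring.
  by move: d2 n_gt0; move: (d ^ 2)%N (n) => dd m; lia.
have char k : (0 < k <= 2 * (3 * d).+1)%N -> k%:R != 0 :> 'F_p.
  case/andP=> k0 kp; rewrite -(dvdn_pcharf (pchar_Fp pr)) gtnNdvd //.
  exact: leq_ltn_trans kp dp.
have := collisions_small dn char; rewrite -/n; clearbody n.
rewrite -(ler_nat R) => /le_trans; apply.
rewrite !natrM !natrD natrM -NE ler_wpM2l // ?mulr_ge0 //.
rewrite -addrA lerD2r.
(* As 6 < (5 / 2)^2; with N >= 1 this gives 5 (3d + 1) <= 45 sqrt N. *)
have dR : d%:R <= 5 / 2 * Num.sqrt N.
  rewrite -(ler_pXn2r (isT : 0 < 2)%N) ?nnegrE ?ler0n ?mulr_ge0 ?sqrtr_ge0 ?invr_ge0 //.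
  rewrite exprMn sqr_sqrtr // -natrX; apply: (@le_trans _ _ (6 * N)).
    by rewrite NE -natrM ler_nat.
  by rewrite ler_wpM2r //; lra.
have s1 : 1 <= Num.sqrt N by rewrite -sqrtr1 ler_sqrt // NE ler1n.
by rewrite -[(3 * d).+1]addn1 natrD natrM; lra.
Qed.

(** * Energies *)

Definition harmonic_sum (R : realFieldType) (n : nat) : R := \sum_(i < n) i.+1%:R^-1.

(** The sum of f is the sum over j >= 1 of the sizes of the level sets f >= j. If k maximizes k |{f
    >= k}|, each size is at most this maximum divided by j. *)
Lemma popular_level (R : realFieldType) (T : finType) (A : {set T}) (f : T -> nat) (n : nat) :
  (0 < n)%N -> (forall x, x \in A -> (f x <= n)%N) ->
  exists2 k, (0 < k)%N &
    (\sum_(x in A) f x)%:R <=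
      k%:R * #|[set x in A | (k <= f x)%N]|%:R * harmonic_sum R n.
Proof.
case: n => // n _ fn.
pose g (i : 'I_n.+1) := (i.+1 * #|[set x in A | (i.+1 <= f x)%N]|)%N.
have [i _ imax] := @arg_maxnP _ (ord0 : 'I_n.+1) xpredT g isT.
exists i.+1 => //; rewrite -natrM -/(g i).
have -> : (\sum_(x in A) f x = \sum_(j < n.+1) #|[set x in A | (j.+1 <= f x)%N]|)%N.
  under [RHS]eq_bigr => j _ do rewrite -sum1dep_card big_mkcondr /=.
  rewrite exchange_big; apply: eq_bigr => x xA; rewrite -big_mkcond /=.
  by rewrite -(big_ord_widen _ (fun=> 1%N) (fn x xA)) sum_nat_const card_ord muln1.
rewrite natr_sum /harmonic_sum mulr_sumr; apply: ler_sum => j _.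
by rewrite ler_pdivlMr ?ltr0n // -natrM ler_nat mulnC; exact: imax.
Qed.

(** * Representation counts and energies *)

Section Energies.

Variable F : finFieldType.
Implicit Types (B C D S X : {set F}).

Definition sums B (s : F) := #|[set z : F * F | [&& z.1 \in B, z.2 \in B & z.1 + z.2 == s]]|.
Definition products C X (y : F) := #|[set z : F * F | [&& z.1 \in C,
  z.2 \in X & z.1 * z.2 == y]]|.

Lemma add_energyE B : add_energy B = (\sum_s sums B s ^ 2)%N.
Proof.
pose f (q : F * F * F * F) := let: (b1, b2, b3, b4) := q in ((b1, b2), (b3, b4)).
have fI : injective f by move=> [[[b1 b2] b3] b4] [[[c1 c2] c3] c4] [-> -> -> ->].
rewrite /add_energy -(card_imset _ fI).
rewrite -sum1_card (partition_big (fun z : (F * F) * (F * F) => z.1.1 + z.1.2) predT) //=.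
apply: eq_bigr => s _; rewrite sum1dep_card -mulnn /sums -cardsX; apply:
  eq_card => -[[b1 b2] [b3 b4]].
rewrite !inE /=; apply/andP/andP.
  case=> /imsetP[[[[c1 c2] c3] c4]]; rewrite inE => /and5P[h1 h2 h3 h4 /eqP h] [-> ->
    -> ->] /eqP <-.
  by rewrite h1 h2 h3 h4 -h !eqxx.
case=> /and3P[h1 h2 /eqP <-] /and3P[h3 h4 /eqP h]; split=> //.
by apply/imsetP; exists (b1, b2, b3, b4) => //; rewrite inE h1 h2 h3 h4 h /=.
Qed.

Lemma mul_energyE C X : mul_energy C X = (\sum_y products C X y ^ 2)%N.
Proof.
pose f (q : F * F * F * F) := let: (c1, c2, x1, x2) := q in ((c1, x1), (c2, x2)).
have fI : injective f by move=> [[[b1 b2] b3] b4] [[[c1 c2] c3] c4] [-> -> -> ->].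
rewrite /mul_energy -(card_imset _ fI).
rewrite -sum1_card (partition_big (fun z : (F * F) * (F * F) => z.1.1 * z.1.2) predT) //=.
apply: eq_bigr => s _; rewrite sum1dep_card -mulnn /products -cardsX; apply:
  eq_card => -[[b1 b2] [b3 b4]].
rewrite !inE /=; apply/andP/andP.
  case=> /imsetP[[[[c1 c2] c3] c4]]; rewrite inE => /and5P[h1 h2 h3 h4 /eqP h] [-> ->
    -> ->] /eqP <-.
  by rewrite h1 h2 h3 h4 -h !eqxx.
case=> /and3P[h1 h2 /eqP <-] /and3P[h3 h4 /eqP h]; split=> //.
by apply/imsetP; exists (b1, b3, b2, b4) => //; rewrite inE h1 h2 h3 h4 h /=.
Qed.

Lemma sums_le B s : (sums B s <= #|B|)%N.
Proof.
rewrite /sums -(@card_in_imset _ _ fst); last first.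
  move=> [x y] [x' y'] /=; rewrite !inE /= => /and3P[_ _ /eqP <-] /and3P[_ _ /eqP E] xx.
  by rewrite -xx in E *; move/addrI: E => ->.
apply/subset_leq_card/fintype.subsetP => _ /imsetP[z + ->].
by rewrite inE => /and3P[].
Qed.

(** These are the representations b = s - b' with s in S and b' in B. *)
Definition completions B S (b : F) := #|[set b' in B | b + b' \in S]|.

Lemma completions_le B S b : (completions B S b <= #|B|)%N.
Proof. by apply/subset_leq_card/fintype.subsetP => x; rewrite inE => /andP[]. Qed.

Lemma sum_completions B S :
  (\sum_(b in B) completions B S b = \sum_(s in S) sums B s)%N.
Proof.
pose P := [set z : F * F | [&& z.1 \in B, z.2 \in B & z.1 + z.2 \in S]].
transitivity #|P|.
  rewrite -sum1_card (partition_big fst (mem B)) /=; last by move=> z; rewrite inE => /and3P[].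
  apply: eq_bigr => b bB; rewrite sum1dep_card /completions.
  rewrite -(@card_imset _ _ (pair b)); last by move=> x y [].
  apply: eq_card => -[x y]; rewrite !inE /=; apply/imsetP/idP.
    by case=> z; rewrite inE => /andP[zB zS] [-> ->]; rewrite bB zB zS /=.
  by case/andP=> /and3P[xB yB xy] /eqP E; exists y; rewrite ?inE -?E // yB.
rewrite -sum1_card (partition_big (fun z => z.1 + z.2) (mem S)) /=; last by move=> z;
  rewrite inE => /and3P[].
apply: eq_bigr => s sS; rewrite sum1dep_card /sums; apply: eq_card => z; rewrite !inE.
by case: eqP => [->|]; rewrite ?sS ?andbT // !andbF.
Qed.

(* Each solution of c1 x1 = c2 x2 extends to l ^ 2 solutions of
   x1 (s1 - b1) = x2 (s2 - b2) when every c has l representations s - b. *)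
Lemma mul_energy_collisions B D S X (l : nat) :
  0 \notin X -> 0 \notin D ->
  (forall d, d \in D -> (l <= completions B S d)%N) ->
  (l ^ 2 * mul_energy D X <= collisions S B X)%N.
Proof.
move=> X0 D0 lD.
pose T := ((F * F * F * F) * (F * F))%type.
pose P := [set z : T | let: ((c1, c2, x1, x2), (b1, b2)) := z in
  [&& [&& c1 \in D, c2 \in D, x1 \in X, x2 \in X & c1 * x1 == c2 * x2],
    (b1 \in B) && (c1 + b1 \in S) & (b2 \in B) && (c2 + b2 \in S)]].
pose f (z : T) := let: ((c1, c2, x1, x2), (b1, b2)) := z in ((c1 + b1, b1, x1), (c2 + b2,
  b2, x2)).
have fI : injective f.
  move=> [[[[c1 c2] x1] x2] [b1 b2]] [[[[d1 d2] y1] y2] [e1 e2]] [E1 be1 -> E2 be2 ->].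
  by move: E1 E2; rewrite be1 be2 => /addIr -> /addIr ->.
apply: (@leq_trans #|P|); last first.
  rewrite -(card_imset _ fI);
    apply/subset_leq_card/fintype.subsetP => _ /imsetP[[[[[c1 c2] x1] x2] [b1 b2]] + ->].
  rewrite !inE /= => /and3P[/and5P[c1D c2D x1X x2X /eqP E] /andP[b1B s1] /andP[b2B s2]].
  rewrite b1B b2B s1 s2 x1X x2X /= !addrK ![_ * c1]mulrC ![_ * c2]mulrC E eqxx /= -E
    mulf_neq0 //.
    by apply: contraNneq D0 => <-.
  by apply: contraNneq X0 => <-.
rewrite -[#|P|]sum1_card (partition_big fst (mem [set q : F * F * F * F | let: (c1, c2, x1,
  x2) := q in
      [&& c1 \in D, c2 \in D, x1 \in X, x2 \in X & c1 * x1 == c2 * x2]])) /=; last first.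
  by move=> [[[[c1 c2] x1] x2] [b1 b2]]; rewrite !inE => /and3P[].
rewrite mulnC /mul_energy -sum_nat_const; apply: leq_sum => -[[[c1 c2] x1] x2].
rewrite inE => h; have /and5P[c1D c2D _ _ _] := h.
rewrite sum1dep_card -mulnn; apply: leq_trans (leq_mul (lD _ c1D) (lD _ c2D)) _.
rewrite /completions -cardsX -(@card_imset _ _ (pair (c1, c2, x1, x2))); last by move=> x y [].
apply/subset_leq_card/fintype.subsetP => _ /imsetP[[b1 b2] + ->].
by rewrite !inE /= => /andP[-> ->]; rewrite h eqxx.
Qed.

(** As x2 is nonzero, c2 is determined by c1, x1 and x2. *)
Lemma mul_energy_trivial C X : 0 \notin X -> (mul_energy C X <= #|X| ^ 2 * #|C|)%N.
Proof.
move=> X0; pose f (q : F * F * F * F) := let: (c1, c2, x1, x2) := q in ((x1, x2), c1).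
rewrite /mul_energy -(@card_in_imset _ _ f); last first.
  move=> [[[c1 c2] x1] x2] [[[d1 d2] y1] y2]; rewrite !inE.
  move=> /and5P[_ _ _ x2X /eqP E] /and5P[_ _ _ _ /eqP E'] [ex1 ex2 ec1].
  rewrite -ex1 -ex2 -ec1 E in E' *.
  have x20 : x2 != 0 by apply: contraNneq X0 => <-.
  by move/(mulIf x20): E' => ->.
rewrite -mulnn -!cardsX;
  apply/subset_leq_card/fintype.subsetP => _ /imsetP[[[[c1 c2] x1] x2] + ->].
by rewrite !inE /= => /and5P[-> _ -> -> _].
Qed.

Lemma products_setU C D X y : (products (C :|: D) X y <= products C X y + products D X y)%N.
Proof.
rewrite /products; apply: leq_trans (leq_card_setU _ _).1.
apply/subset_leq_card/fintype.subsetP => z; rewrite !inE.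
by case/and3P=> /orP[] -> -> ->; rewrite ?orbT.
Qed.

(** The square root of the energy is an l^2 norm, hence subadditive in C. The weighted
    Cauchy-Schwarz inequality makes the scales c and d add up without loss. *)
Lemma mul_energy_setU (R : realFieldType) C D X (c d W : R) :
  0 < c -> 0 < d ->
  (mul_energy C X)%:R <= c ^+ 2 * W -> (mul_energy D X)%:R <= d ^+ 2 * W ->
  (mul_energy (C :|: D) X)%:R <= (c + d) ^+ 2 * W.
Proof.
move=> c0 d0; rewrite !mul_energyE !natr_sum => hC hD.
apply: (@le_trans _ _ (\sum_y ((c + d) / c * (products C X y ^ 2)%:R + (c +
  d) / d * (products D X y ^ 2)%:R))).
  apply: ler_sum => y _; rewrite !natrX.
  have : (products (C :|: D) X y)%:R <= (products C X y)%:R + (products D X y)%:R :> R.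
    by rewrite -natrD ler_nat products_setU.
  have : 0 <= (products (C :|: D) X y)%:R :> R by rewrite ler0n.
  move: ((products (C :|: D) X y)%:R : R) ((products C X y)%:R : R) ((products D X y)%:R : R).
  move=> m m1 m2 m0 mm.
  apply: (@le_trans _ _ ((m1 + m2) ^+ 2)); first by rewrite ler_pXn2r ?nnegrE // (le_trans m0).
  rewrite -subr_ge0 (_ : _ - _ = (d * m1 - c * m2) ^+ 2 / (c * d)); last first.
    by field; rewrite !gt_eqF.
  by rewrite divr_ge0 ?sqr_ge0 // mulr_ge0 // ltW.
rewrite big_split -!mulr_sumr /=.
have -> : (c + d) ^+ 2 * W = (c + d) / c * (c ^+ 2 * W) + (c + d) / d * (d ^+ 2 * W).
  by field; rewrite !gt_eqF.
by rewrite lerD // ler_wpM2l // divr_ge0 ?addr_ge0 // ltW.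
Qed.

End Energies.

(** * Extraction of a structured piece, and its iteration *)

Lemma ler_sqr_ge0 (R : realDomainType) (x y : R) : 0 <= y -> x ^+ 2 <= y ^+ 2 -> x <= y.
Proof.
move=> y0 xy; have [x0|x0] := leP 0 x; last exact: le_trans (ltW x0) y0.
by rewrite -(ler_pXn2r (isT : 0 < 2)%N) ?nnegrE.
Qed.

(** Here n = |B|, E is the additive energy of B, q the number of sums whose squared multiplicity is
    at least k, x = |X|, Q the number of collisions, and h a bound for harmonic sums. Large energy
    enters as [hyp]; the four terms of the bound on Q are compared separately. *)
Lemma extraction_ineq (R : rcfType) (n a E k q x M h P N Q : R) :
  0 < n -> n <= a -> 1 <= M -> M <= x -> 1 <= h -> 0 < P -> 0 < k -> 0 < q ->
  0 < E -> E <= k * q * h -> q ^+ 2 * k <= n ^+ 4 ->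
  a ^+ 2 * n ^+ 7 <= E ^+ 3 * M ^+ 3 -> E <= n ^+ 3 -> N = q * n * x ->
  Q <= 290 * (N ^+ 2 / P) + 4 * N * (45 * Num.sqrt N + q + n) ->
  Q <= 290 * h ^+ 2 * (q ^+ 2 * k) *
       (x ^+ 2 * M ^+ 2 / P + x * Num.sqrt x * (M * Num.sqrt M) / a).
Proof.
move=> n0 na M1 Mx h1 P0 k0 q0 E0 Ekq qk hyp En NE.
have M0 : 0 < M by lra. have x0 : 0 < x by lra. have h0 : 0 < h by lra. have a0 : 0 < a by lra.
have N0 : 0 < N by rewrite NE !mulr_gt0.
have [[[n0' a0'] M0'] x0'] := (ltW n0, ltW a0, ltW M0, ltW x0).
have [[[h0' P0'] k0'] q0'] := (ltW h0, ltW P0, ltW k0, ltW q0).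
have [E0' N0'] := (ltW E0, ltW N0).
have E2 : E ^+ 2 <= k * n ^+ 4 * h ^+ 2.
  have /le_trans : E ^+ 2 <= (k * q * h) ^+ 2 by rewrite ler_pXn2r ?nnegrE ?mulr_ge0.
  apply; have -> : (k * q * h) ^+ 2 = k * (q ^+ 2 * k) * h ^+ 2 by ring.
  by rewrite ler_wpM2r ?exprn_ge0 // ler_wpM2l.
have EM : n ^+ 3 <= E * M.
  rewrite -(ler_pXn2r (isT : 0 < 3)%N) ?nnegrE ?exprn_ge0 ?mulr_ge0 //.
  rewrite [(E * M) ^+ 3]exprMn -exprM.
  apply: le_trans hyp; rewrite (_ : n ^+ (3 * 3) = n ^+ 2 * n ^+ 7); last by rewrite -exprD.
  by rewrite ler_wpM2r ?exprn_ge0 // ler_pXn2r ?nnegrE.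
(* [E2] bounds k from below, so it suffices to compare with E^2 M^2. *)
have kM (z : R) : n ^+ 4 * z <= E ^+ 2 * M ^+ 2 -> z <= h ^+ 2 * k * M ^+ 2.
  move=> hz; rewrite -(ler_pM2l (exprn_gt0 4 n0)); apply: le_trans hz _.
  have -> : n ^+ 4 * (h ^+ 2 * k * M ^+ 2) = k * n ^+ 4 * h ^+ 2 * M ^+ 2 by ring.
  by rewrite ler_wpM2r ?exprn_ge0.
have T1 : N ^+ 2 / P <= h ^+ 2 * (q ^+ 2 * k) * (x ^+ 2 * M ^+ 2 / P).
  rewrite mulrA ler_wpM2r ?invr_ge0 // NE.
  have -> : (q * n * x) ^+ 2 = q ^+ 2 * x ^+ 2 * n ^+ 2 by ring.
  have -> : h ^+ 2 * (q ^+ 2 * k) * (x ^+ 2 * M ^+ 2) =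
    q ^+ 2 * x ^+ 2 * (h ^+ 2 * k * M ^+ 2) by ring.
  rewrite ler_wpM2l ?mulr_ge0 ?exprn_ge0 //; apply: kM.
  rewrite -exprMn -exprD (_ : n ^+ 6 = (n ^+ 3) ^+ 2); last by rewrite -exprM.
  by rewrite ler_pXn2r ?nnegrE ?exprn_ge0 ?mulr_ge0.
pose sx := Num.sqrt x; pose sM := Num.sqrt M.
have sx2 : sx ^+ 2 = x by rewrite sqr_sqrtr.
have sM2 : sM ^+ 2 = M by rewrite sqr_sqrtr.
have sM1 : 1 <= sM by rewrite -sqrtr1 ler_sqrt.
have sMx : sM <= sx by rewrite ler_sqrt.
have sx1 : 1 <= sx by exact: le_trans sMx.
pose W := h ^+ 2 * (q ^+ 2 * k) * (x * sx * (M * sM) / a).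
have W0 : 0 <= W by rewrite /W !mulr_ge0 ?invr_ge0 ?exprn_ge0 ?sqrtr_ge0 //.
have toW y : a * y <= h ^+ 2 * (q ^+ 2 * k) * (x * sx * (M * sM)) -> y <= W.
  by rewrite /W [_ * (_ / a)]mulrA ler_pdivlMr // [y * a]mulrC.
have T2 : N * Num.sqrt N <= W.
  apply: toW; apply: ler_sqr_ge0; first by rewrite !mulr_ge0 ?exprn_ge0 ?sqrtr_ge0 //.
  have -> : (a * (N * Num.sqrt N)) ^+ 2 = a ^+ 2 * N ^+ 2 * Num.sqrt N ^+ 2 by ring.
  rewrite sqr_sqrtr // NE.
  have -> : (h ^+ 2 * (q ^+ 2 * k) * (x * sx * (M * sM))) ^+ 2 =
    h ^+ 4 * q ^+ 4 * k ^+ 2 * x ^+ 2 * M ^+ 2 * (sx ^+ 2) * (sM ^+ 2) by ring.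
  rewrite sx2 sM2.
  have -> : a ^+ 2 * (q * n * x) ^+ 2 * (q * n * x) =
    q ^+ 3 * x ^+ 3 * (a ^+ 2 * n ^+ 3) by ring.
  have -> : h ^+ 4 * q ^+ 4 * k ^+ 2 * x ^+ 2 * M ^+ 2 * x * M =
    q ^+ 3 * x ^+ 3 * (h ^+ 4 * q * k ^+ 2 * M ^+ 3) by ring.
  rewrite ler_wpM2l ?mulr_ge0 ?exprn_ge0 //.
  rewrite -(ler_pM2l (exprn_gt0 4 n0)).
  have -> : n ^+ 4 * (a ^+ 2 * n ^+ 3) = a ^+ 2 * n ^+ 7 by ring.
  apply: le_trans hyp _.
  have -> : n ^+ 4 * (h ^+ 4 * q * k ^+ 2 * M ^+ 3) =
    (k * q * h) * (k * n ^+ 4 * h ^+ 2) * M ^+ 3 * h by ring.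
  apply: (@le_trans _ _ ((k * q * h) * (k * n ^+ 4 * h ^+ 2) * M ^+ 3)).
    rewrite ler_wpM2r ?exprn_ge0 // exprS.
    by rewrite ler_pM ?exprn_ge0.
  by rewrite ler_peMr // !mulr_ge0 ?exprn_ge0.
have T3 : N * q <= W.
  apply: toW; rewrite NE.
  apply: (@le_trans _ _ (q ^+ 2 * x * (h ^+ 2 * k * M ^+ 2))).
    have -> : a * (q * n * x * q) = q ^+ 2 * x * (n * a) by ring.
    rewrite ler_wpM2l ?mulr_ge0 ?exprn_ge0 //; apply: kM.
    (* Cubed, n^5 a <= E^2 M^2 follows from the square of [hyp], as n <= a. *)
    rewrite -(ler_pXn2r (isT : 0 < 3)%N) ?nnegrE ?exprn_ge0 ?mulr_ge0 ?exprn_ge0 //.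
    apply: (@le_trans _ _ ((a ^+ 2 * n ^+ 7) ^+ 2)).
      have -> : (n ^+ 4 * (n * a)) ^+ 3 = a ^+ 3 * n ^+ 14 * n by ring.
      have -> : (a ^+ 2 * n ^+ 7) ^+ 2 = a ^+ 3 * n ^+ 14 * a by ring.
      by rewrite ler_wpM2l ?mulr_ge0 ?exprn_ge0.
    have -> : (E ^+ 2 * M ^+ 2) ^+ 3 = (E ^+ 3 * M ^+ 3) ^+ 2 by ring.
    by rewrite ler_pXn2r ?nnegrE ?mulr_ge0 ?exprn_ge0.
  have -> : q ^+ 2 * x * (h ^+ 2 * k * M ^+ 2) = h ^+ 2 * (q ^+ 2 * k) * (x * M) * M by ring.
  have -> : h ^+ 2 * (q ^+ 2 * k) * (x * sx * (M * sM)) =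
    h ^+ 2 * (q ^+ 2 * k) * (x * M) * (sx * sM) by ring.
  rewrite ler_wpM2l ?mulr_ge0 ?exprn_ge0 // -[leLHS]sM2 expr2 ler_wpM2r //; lra.
(* Here one factor E of [hyp] is spent on E <= n^3. *)
have T4 : N * n <= W.
  apply: toW; rewrite NE.
  apply: (@le_trans _ _ (q * x * (h ^+ 2 * (q * k) * (M * sM)))).
    have -> : a * (q * n * x * n) = q * x * (a * n ^+ 2) by ring.
    rewrite ler_wpM2l ?mulr_ge0 //; apply: ler_sqr_ge0.
      by rewrite !mulr_ge0 ?exprn_ge0 ?sqrtr_ge0 //.
    have -> : (h ^+ 2 * (q * k) * (M * sM)) ^+ 2 =
      (k * q * h) ^+ 2 * h ^+ 2 * (M ^+ 2 * sM ^+ 2) by ring.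
    rewrite sM2; apply: (@le_trans _ _ (E ^+ 2 * M ^+ 3)).
      rewrite -(ler_pM2r (exprn_gt0 3 n0)).
      have -> : (a * n ^+ 2) ^+ 2 * n ^+ 3 = a ^+ 2 * n ^+ 7 by ring.
      apply: le_trans hyp _.
      have -> : E ^+ 3 * M ^+ 3 = E ^+ 2 * M ^+ 3 * E by ring.
      by rewrite ler_wpM2l ?mulr_ge0 ?exprn_ge0.
    have -> : M ^+ 2 * M = M ^+ 3 by ring.
    rewrite ler_wpM2r ?exprn_ge0 //; apply: (@le_trans _ _ ((k * q * h) ^+ 2)).
      by rewrite ler_pXn2r ?nnegrE ?mulr_ge0.
    by rewrite ler_peMr ?exprn_ge0 ?mulr_ge0 // exprn_ege1.
  have -> : q * x * (h ^+ 2 * (q * k) * (M * sM)) =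
    h ^+ 2 * (q ^+ 2 * k) * (x * (M * sM)) by ring.
  have -> : h ^+ 2 * (q ^+ 2 * k) * (x * sx * (M * sM)) =
    h ^+ 2 * (q ^+ 2 * k) * (x * (M * sM)) * sx by ring.
  by rewrite ler_peMr // !mulr_ge0 ?exprn_ge0 ?sqrtr_ge0 //.
move=> /le_trans; apply.
have -> : 290 * h ^+ 2 * (q ^+ 2 * k) * (x ^+ 2 * M ^+ 2 / P +
  x * Num.sqrt x * (M * Num.sqrt M) / a) =
  290 * (h ^+ 2 * (q ^+ 2 * k) * (x ^+ 2 * M ^+ 2 / P)) + 290 * W by rewrite /W /sx /sM; ring.
have -> : 4 * N * (45 * Num.sqrt N + q + n) = 180 * (N * Num.sqrt N) + 4 * (N * q) +
  4 * (N * n) by ring.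
lra.
Qed.

(** Two pigeonholings: squared multiplicities of sums give the popular sums S at level k, then
    completions into S give D at level l. The total multiplicity of S is at least |S| sqrt k and at
    most l |D| h. *)
Lemma extraction (R : rcfType) (p : nat) (B : {set 'F_p}) (a M h : R) :
  prime p -> B != finset.set0 -> #|B|%:R <= a -> 1 <= M -> 1 <= h ->
  harmonic_sum R #|B| <= h -> harmonic_sum R (#|B| ^ 2) <= h ->
  a ^+ 2 * #|B|%:R ^+ 7 <= (add_energy B)%:R ^+ 3 * M ^+ 3 ->
  exists D : {set 'F_p}, [/\ D \subset B, D != finset.set0 &
    forall X : {set 'F_p}, 0 \notin X -> M <= #|X|%:R ->
      (mul_energy (D :\ 0) X)%:R <= #|D|%:R ^+ 2 * (290 * h ^+ 4 *
        (#|X|%:R ^+ 2 * M ^+ 2 / p%:R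
         + #|X|%:R * Num.sqrt #|X|%:R * (M * Num.sqrt M) / a))].
Proof.
move=> pr B0 nBa M1 h1 hn hn2 hyp; set n := #|B| in nBa hn hn2 hyp.
have n_gt0 : (0 < n)%N by rewrite card_gt0.
have h0 : 0 < h by lra.
have p_gt0 : 0 < p%:R :> R by rewrite ltr0n prime_gt0.
have [] := @popular_level R _ [set: 'F_p] (fun s => sums B s ^ 2)%N (n ^ 2)%N.
- by rewrite expn_gt0 n_gt0.
- by move=> s _; rewrite leq_exp2r // sums_le.
move=> k k_gt0; pose S := [set s | (k <= sums B s ^ 2)%N].
have -> : [set s in [set: 'F_p] | (k <= sums B s ^ 2)%N] = S by apply/setP => s; rewrite !inE.
have -> : (\sum_(s in [set: 'F_p]) sums B s ^ 2 = add_energy B)%N.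
  by rewrite add_energyE; apply: eq_bigl => s; rewrite inE.
move=> Ek; pose sg := (\sum_(s in S) sums B s)%N.
have sg_le (T : {set 'F_p}) : (\sum_(s in T) sums B s <= n ^ 2)%N.
  rewrite -sum_completions -mulnn -sum_nat_const leq_sum // => b _.
  exact: completions_le.
have [b _|l l_gt0] := @popular_level R _ B (completions B S) n n_gt0.
  exact: completions_le.
rewrite sum_completions -/sg; set D := [set b in B | _] => sgl.
pose q := #|S|.
have qsg : q%:R * Num.sqrt k%:R <= sg%:R :> R.
  rewrite mulr_natl -sumr_const /sg natr_sum; apply: ler_sum => s; rewrite inE => ks.
  have -> : (sums B s)%:R = Num.sqrt ((sums B s)%:R ^+ 2) :> R by rewrite sqrtr_sqr ger0_norm.
  by rewrite ler_sqrt ?sqr_ge0 // -natrX ler_nat.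
have Egt0 : (0 < add_energy B)%N.
  rewrite lt0n; apply: contraTneq isT => E0; move: hyp; rewrite E0 expr0n mul0r.
  rewrite leNgt mulr_gt0 ?exprn_gt0 ?ltr0n //; apply: lt_le_trans nBa; by rewrite ltr0n.
have Ele : (add_energy B <= n ^ 3)%N.
  rewrite add_energyE (@leq_trans (\sum_s n * sums B s)) //.
    by apply: leq_sum => s _; rewrite -mulnn leq_mul2r sums_le orbT.
  rewrite -big_distrr /= expnS leq_mul2l; apply/orP; right.
  by apply: leq_trans (sg_le [set: 'F_p]); apply/eq_leq/eq_bigl => s; rewrite inE.
have Ekq : (add_energy B)%:R <= k%:R * q%:R * h :> R.
  by apply: le_trans Ek _; rewrite ler_wpM2l ?mulr_ge0.
have q_gt0 : (0 < q)%N.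
  rewrite lt0n; apply: contraTneq Ekq => ->; rewrite mulr0 mul0r -ltNge ltr0n //.
have kR : 0 < k%:R :> R by rewrite ltr0n.
have qR : 0 < q%:R :> R by rewrite ltr0n.
have qk_sg : q%:R ^+ 2 * k%:R <= sg%:R ^+ 2 :> R.
  have -> : q%:R ^+ 2 * k%:R =
    (q%:R * Num.sqrt k%:R) ^+ 2 :> R by rewrite exprMn sqr_sqrtr ?ler0n.
  by rewrite ler_pXn2r ?nnegrE ?mulr_ge0 ?sqrtr_ge0 ?ler0n.
have sgR : 0 < sg%:R :> R by apply: lt_le_trans qsg; rewrite mulr_gt0 // sqrtr_gt0.
have sgl' : sg%:R <= l%:R * #|D|%:R * h :> R.
  by apply: le_trans sgl _; rewrite ler_wpM2l ?mulr_ge0.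
have qk_n : q%:R ^+ 2 * k%:R <= n%:R ^+ 4 :> R.
  apply: le_trans qk_sg _; rewrite (_ : n%:R ^+ 4 = (n ^ 2)%:R ^+ 2);
    last by rewrite natrX -exprM.
  by rewrite ler_pXn2r ?nnegrE ?ler0n // ler_nat sg_le.
exists D; split.
- by apply/fintype.subsetP => b; rewrite inE => /andP[].
- by apply: contraTneq sgl' => ->; rewrite cards0 mulr0 mul0r -ltNge.
move=> X X0 MX.
pose N : R := (#|S| * #|B| * #|X|)%:R.
have Q1 := @collisions_bound R p S B X N pr erefl.
have Q2 := extraction_ineq (n := n%:R) (a := a) (E := (add_energy B)%:R) (k := k%:R) (q := q%:R)
  (x := #|X|%:R) (M := M) (h := h) (P := p%:R) (N := N) (Q := (collisions S B X)%:R).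
have {Q1}Q2 : (collisions S B X)%:R <= 290 * h ^+ 2 * (q%:R ^+ 2 * k%:R) *
       (#|X|%:R ^+ 2 * M ^+ 2 / p%:R + #|X|%:R * Num.sqrt #|X|%:R * (M * Num.sqrt M) / a).
  apply: Q2 => //; rewrite ?ltr0n //; first by rewrite -natrX ler_nat.
  by rewrite /N !natrM.
set W := 290 * _ * _.
set Z := _ + _ in Q2 W *.
have Ecol : (l ^ 2 * mul_energy (D :\ 0%R) X <= collisions S B X)%N.
  apply: mul_energy_collisions => //; first by rewrite !inE eqxx.
  by move=> d; rewrite !inE => /and3P[].
(* After multiplication by q^2 k <= (l |D| h)^2, the factor l^2 is absorbed by [Ecol], and the q^2 k
   in [Q2] matches the one introduced here. *)
rewrite -(ler_pM2r (_ : 0 < q%:R ^+ 2 * k%:R)); last by rewrite mulr_gt0 ?exprn_gt0.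
apply: (@le_trans _ _ ((mul_energy (D :\ 0) X)%:R * (l%:R * #|D|%:R * h) ^+ 2)).
  rewrite ler_wpM2l ?ler0n //; apply: le_trans qk_sg _.
  by rewrite ler_pXn2r ?nnegrE ?mulr_ge0 ?(ltW h0).
have -> : (mul_energy (D :\ 0) X)%:R * (l%:R * #|D|%:R * h) ^+ 2 =
   (l ^ 2 * mul_energy (D :\ 0) X)%:R * (#|D|%:R * h) ^+ 2 :> R by rewrite natrM natrX; ring.
apply: (@le_trans _ _ ((collisions S B X)%:R * (#|D|%:R * h) ^+ 2)).
  by rewrite ler_wpM2r ?sqr_ge0 // ler_nat.
apply: (@le_trans _ _ (290 * h ^+ 2 * (q%:R ^+ 2 * k%:R) * Z * (#|D|%:R * h) ^+ 2)).
  by rewrite ler_wpM2r ?sqr_ge0.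
by rewrite /W le_eqVlt; apply/orP; left; apply/eqP; ring.
Qed.

(** While [low] fails, a set D is split off. The weights |C| and |D| in [mul_energy_setU] add up to
    the size of the union, so the number of rounds costs nothing. *)
Lemma decomposition (R : rcfType) (p : nat) (A : {set 'F_p}) (M h : R)
    (low : {set 'F_p} -> Prop) :
  prime p -> 1 <= M -> 1 <= h ->
  (forall n, (n <= #|A| ^ 2)%N -> harmonic_sum R n <= h) ->
  (forall B : {set 'F_p}, B \subset A -> low B \/
     B != finset.set0 /\
     #|A|%:R ^+ 2 * #|B|%:R ^+ 7 <= (add_energy B)%:R ^+ 3 * M ^+ 3) ->
  exists B C : {set 'F_p}, [/\ A = B :|: C, [disjoint B & C], low B &
    forall X : {set 'F_p}, 0 \notin X -> M <= #|X|%:R ->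
      (mul_energy (C :\ 0) X)%:R <= #|C|%:R ^+ 2 * (290 * h ^+ 4 *
        (#|X|%:R ^+ 2 * M ^+ 2 / p%:R
         + #|X|%:R * Num.sqrt #|X|%:R * (M * Num.sqrt M) / #|A|%:R))].
Proof.
move=> pr M1 h1 harm alt; pose W (X : {set 'F_p}) : R := 290 * h ^+ 4 *
        (#|X|%:R ^+ 2 * M ^+ 2 / p%:R
         + #|X|%:R * Num.sqrt #|X|%:R * (M * Num.sqrt M) / #|A|%:R).
suff main (T : {set 'F_p}) : T \subset A -> exists B C : {set 'F_p},
    [/\ T = B :|: C, [disjoint B & C], low B &
    forall X : {set 'F_p}, 0 \notin X -> M <= #|X|%:R ->
      (mul_energy (C :\ 0) X)%:R <= #|C|%:R ^+ 2 * W X].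
  exact: main (fintype.subxx A).
have [m] := ubnP #|T|; elim: m T => // m IH T; rewrite ltnS => Tm TA.
have [lowT|[T0 hyp]] := alt T TA.
  exists T, finset.set0; rewrite setU0; split=> //.
    by rewrite disjoints_subset setC0 subsetT.
  move=> X X0 _.
  have -> : (finset.set0 :\ 0 : {set 'F_p}) = finset.set0 by rewrite set0D.
  rewrite cards0 expr0n mul0r (_ : mul_energy _ _ = 0%N) //.
  by apply/eqP; rewrite cards_eq0; apply/eqP/setP => -[[[c1 c2] x1] x2]; rewrite !inE.
have TA' := subset_leq_card TA.
have [|||D [DT D0 DX]] := extraction pr T0 _ M1 h1 _ _ hyp.
- by rewrite ler_nat.
- by apply/harm/(leq_trans TA'); rewrite -mulnn leq_pmulr // (leq_trans _ TA') // card_gt0.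
- by apply: harm; rewrite leq_exp2r.
have Tm' : (#|T :\: D| < m)%N.
  rewrite cardsD (setIidPr DT); have := subset_leq_card DT; have :
    (0 < #|D|)%N by rewrite card_gt0.
  move: Tm; move: (#|T|) (#|D|) => t d; lia.
have [|B [C [TDE disj lowB CX]]] := IH _ Tm' _.
  exact: fintype.subset_trans (subsetDl _ _) TA.
have CT : C \subset T :\: D by rewrite TDE subsetUr.
exists B, (C :|: D); split=> //.
- by rewrite finset.setUA -TDE setUC; apply/setP => z; rewrite !inE;
  have /fintype.subsetP/(_ z) := DT; case: (z \in D) => //= ->.
- rewrite disjoints_subset setCU subsetI -!disjoints_subset disj /=.
  have /fintype.subsetP BT : B \subset T :\: D by rewrite TDE subsetUl.
  rewrite disjoint_sym disjoints_subset; apply/fintype.subsetP => z zD; rewrite inE.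
  by apply: contraTN zD => /BT; rewrite inE => /andP[].
move=> X X0 MX.
have CD : #|C :|: D| = (#|C| + #|D|)%N.
  rewrite cardsU (_ : C :&: D = finset.set0) ?cards0 ?subn0 //.
  apply/eqP; rewrite setI_eq0 disjoints_subset; apply: fintype.subset_trans CT _.
  by rewrite finset.setDE subsetIr.
have [C0|C0] := eqVneq C finset.set0; first by rewrite C0 finset.set0U; exact: DX.
have -> : (C :|: D) :\ 0 = (C :\ 0) :|: (D :\ 0) by rewrite setDUl.
rewrite CD natrD; apply: mul_energy_setU; rewrite ?ltr0n ?card_gt0 //.
  exact: CX.
exact: DX.
Qed.

(* Logarithms, fractional powers and the conclusion *)
From mathcomp Require Import all_classical all_reals all_analysis.

(** Induction, with ln (1 - 1 / m) <= - 1 / m. *)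
Lemma harmonic_sum_le (R : realType) (n : nat) : (0 < n)%N ->
  harmonic_sum R n <= 1 + ln n%:R.
Proof.
case: n => // n _; elim: n => [|n IH].
  by rewrite /harmonic_sum big_ord1 invr1 ln1 addr0.
rewrite /harmonic_sum big_ord_recr /= -/(harmonic_sum R n.+1).
have n0 : 0 < n.+1%:R :> R by []. have n0' : 0 < n.+2%:R :> R by [].
have : ln (1 + - n.+2%:R^-1) <= - n.+2%:R^-1 :> R.
  by apply: le_ln1Dx; rewrite ltrN2 invf_lt1 // ltr1n.
have -> : 1 + - n.+2%:R^-1 = n.+1%:R / n.+2%:R :> R.
  have n2 : n.+2%:R != 0 :> R by rewrite gt_eqF.
  by apply: (mulIf n2); rewrite mulrDl mulNr mulVf // divfK // mul1r -(natr1 n.+1) addrK.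
rewrite ln_div ?posrE //.
by move: (harmonic_sum _ _) (ln n.+1%:R) (ln n.+2%:R) (n.+2%:R^-1) IH => a b c d; lra.
Qed.

Lemma powR_3half (R : realType) (x : R) : 0 <= x -> x `^ (3 / 2) = x * Num.sqrt x.
Proof.
move=> x0; rewrite -mulr_powRB1 // (_ : 3 / 2 - 1 = 2^-1); last by field.
by rewrite powR12_sqrt.
Qed.

Lemma powR_third_cube (R : realType) (x : R) (k : nat) : 0 <= x ->
  (x `^ (k%:R / 3)) ^+ 3 = x ^+ k.
Proof.
move=> x0; rewrite -powR_mulrn ?powR_ge0 // -powRrM divfK ?powR_mulrn //.
Qed.

(* Zero is removed from C and X in the multiplicative energy: the degenerate
   solutions c1 * x1 = c2 * x2 = 0 need not obey the bound.  For instance, take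
   A = [set 0], M = 2, X the whole field and p large.  When A and X consist of
   nonzero elements, this is the energy of C and X themselves. *)
Theorem theorem43 (R : realType) :
  exists K c : R, 0 < K /\ 0 < c /\
  forall (p : nat) (A : {set 'F_p}) (M : R),
    prime p -> odd p -> A != finset.set0 ->
    1 <= M -> M <= p%:R / (2 * #|A|%:R) ->
    exists B C : {set 'F_p},
      [/\ A = B :|: C,
          [disjoint B & C],
          (add_energy B)%:R - #|B|%:R ^+ 4 / p%:R
            <= #|A|%:R `^ (2 / 3) * #|B|%:R `^ (7 / 3) / M :> R
        & forall X : {set 'F_p},
            le_up_to_log K c #|A|
              (mul_energy (C :\ 0) (X :\ 0))%:R
              (M ^+ 2 * #|X|%:R ^+ 2 * #|A|%:R ^+ 2 / p%:R
               + M `^ (3 / 2) * #|A|%:R * #|X|%:R `^ (3 / 2))].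
Proof.
(* The harmonic sums up to |A|^2 are at most 1 + 2 ln |A| <= 3 L, and this bound enters to the
   fourth power: 81 = 3^4. *)
exists (290 * 81), 4; split; first by lra.
split=> // p A M pr _ A0 M1 _.
have M0 : 0 < M by lra.
have p0 : 0 < p%:R :> R by rewrite ltr0n prime_gt0.
have a_gt0 : (0 < #|A|)%N by rewrite card_gt0.
have a0 : 0 < #|A|%:R :> R by rewrite ltr0n.
have a1 : 1 <= #|A|%:R :> R by rewrite ler1n.
pose L : R := Num.max 1 (ln #|A|%:R).
have L1 : 1 <= L by rewrite le_max lexx.
have lnL : ln #|A|%:R <= L by rewrite le_max lexx orbT.
have harm n : (n <= #|A| ^ 2)%N -> harmonic_sum R n <= 3 * L.
  case: (posnP n) => [-> _|n0 nA]; first by rewrite /harmonic_sum big_ord0; lra.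
  apply: le_trans (harmonic_sum_le R n0) _.
  have : ln n%:R <= ln (#|A|%:R ^+ 2) :> R.
    by rewrite ler_ln ?posrE ?exprn_gt0 ?ltr0n // -natrX ler_nat.
  by rewrite lnXn // mulr2n; lra.
pose low (B : {set 'F_p}) := (add_energy B)%:R - #|B|%:R ^+ 4 / p%:R
            <= #|A|%:R `^ (2 / 3) * #|B|%:R `^ (7 / 3) / M :> R.
have alt (B : {set 'F_p}) : B \subset A -> low B \/ B != finset.set0 /\
     #|A|%:R ^+ 2 * #|B|%:R ^+ 7 <= (add_energy B)%:R ^+ 3 * M ^+ 3.
  move=> BA; have [|] := boolP (low B); first by left.
  rewrite /low -ltNge => high; right; split.
    apply: contraTneq high => B0; rewrite -leNgt B0.
    have -> : add_energy (finset.set0 : {set 'F_p}) = 0%N.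
      by apply/eqP; rewrite cards_eq0; apply/eqP/finset.setP => -[[[x1 x2] x3] x4];
        rewrite !inE.
    rewrite cards0 expr0n mul0r subr0 mulr_ge0 ?mulr_ge0 ?powR_ge0 // invr_ge0 ltW //.
  (* The subtracted |B|^4 / p is dropped, and cubing clears the fractional exponents. *)
  have : #|A|%:R `^ (2 / 3) * #|B|%:R `^ (7 / 3) <= (add_energy B)%:R * M :> R.
    rewrite -ler_pdivrMr //; apply: ltW; apply: lt_le_trans high _.
    by rewrite gerBl divr_ge0 ?exprn_ge0 // ltW.
  move=> /(lerXn2r 3); rewrite !nnegrE !mulr_ge0 ?powR_ge0 ?(ltW M0) // => /(_ isT isT).
  by rewrite [leLHS]exprMn [leRHS]exprMn !powR_third_cube.
have h1 : 1 <= 3 * L by lra.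
have [B [C [ABC disj lowB CX]]] := decomposition pr M1 h1 harm alt.
exists B, C; split=> // X; rewrite /le_up_to_log -/L.
have L0 : 0 <= L by lra.
rewrite (powR_mulrn 4 L0) !powR_3half ?(ltW M0) //.
pose X' := X :\ 0; have X'0 : 0 \notin X' by rewrite !inE eqxx.
have X'X : #|X'|%:R <= #|X|%:R :> R by rewrite ler_nat subset_leq_card // finset.subsetDl.
set x' : R := #|X'|%:R in X'X; set x : R := #|X|%:R in X'X *.
have x'0 : 0 <= x' by rewrite ler0n. have x0 : 0 <= x by rewrite ler0n.
have CA : #|C|%:R <= #|A|%:R :> R by rewrite ler_nat subset_leq_card // ABC finset.subsetUr.
have sx : Num.sqrt x' <= Num.sqrt x by rewrite ler_sqrt.
have KL : 1 <= 290 * 81 * L ^+ 4.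
  rewrite -[1]mulr1 ler_pM // ?exprn_ege1 // ; lra.
have T0 : 0 <= M ^+ 2 * x ^+ 2 * #|A|%:R ^+ 2 / p%:R.
  by rewrite divr_ge0 ?mulr_ge0 ?sqr_ge0 // ltW.
have [xM|Mx] := leP M x'.
  apply: le_trans (CX X' X'0 xM) _; rewrite -/x'.
  have -> : 290 * 81 * L ^+ 4 * (M ^+ 2 * x ^+ 2 * #|A|%:R ^+ 2 / p%:R +
    M * Num.sqrt M * #|A|%:R * (x * Num.sqrt x)) =
     #|A|%:R ^+ 2 * (290 * (3 * L) ^+ 4 * (x ^+ 2 * M ^+ 2 / p%:R +
       x * Num.sqrt x * (M * Num.sqrt M) / #|A|%:R)).
    by field; rewrite !gt_eqF.
  have s0 (z : R) : 0 <= Num.sqrt z := sqrtr_ge0 z.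
  have : 0 <= 290 * (3 * L) ^+ 4.
    by apply: mulr_ge0; [exact: ler0n | apply: exprn_ge0; lra].
  move: (290 * _) => T T_ge0; have [[M0' p0'] a0'] := (ltW M0, ltW p0, ltW a0).
  apply: ler_pM; rewrite ?sqr_ge0 //.
  - by rewrite !mulr_ge0 ?addr_ge0 ?divr_ge0 ?mulr_ge0 ?exprn_ge0.
  - by rewrite ler_pXn2r ?nnegrE.
  rewrite ler_wpM2l // lerD // ler_wpM2r ?invr_ge0 //.
    by rewrite ler_wpM2r ?sqr_ge0 // ler_pXn2r ?nnegrE.
  by rewrite ler_wpM2r ?mulr_ge0 // ler_pM.
(* For x' < M the trivial bound suffices, because sqrt x' <= sqrt M <= M sqrt M. *)
have triv : (mul_energy (C :\ 0) X')%:R <= x' ^+ 2 * #|A|%:R :> R.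
  apply: (@le_trans _ _ (x' ^+ 2 * #|C :\ (0 : 'F_p)|%:R)).
    by rewrite -natrX -natrM ler_nat mul_energy_trivial.
  rewrite ler_wpM2l ?sqr_ge0 //; apply: le_trans CA.
  by rewrite ler_nat subset_leq_card // finset.subsetDl.
apply: le_trans triv _; set Z := _ + _.
have Z0 : x' ^+ 2 * #|A|%:R <= Z.
  rewrite -[leLHS]add0r lerD //.
  have sM1 : 1 <= Num.sqrt M by rewrite -sqrtr1 ler_sqrt // ltW.
  have sMx : Num.sqrt x' <= Num.sqrt M by rewrite ler_sqrt // ltW.
  have -> : x' ^+ 2 * #|A|%:R = Num.sqrt x' * #|A|%:R * (x' * Num.sqrt x').
    by rewrite -[in LHS](sqr_sqrtr x'0) -[in RHS](sqr_sqrtr x'0) sqrtr_sqr ger0_norm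
      ?sqrtr_ge0 //; ring.
  apply: ler_pM; rewrite ?mulr_ge0 ?sqrtr_ge0 //.
    by rewrite ler_wpM2r // (le_trans sMx) // ler_peMl // sqrtr_ge0.
  by rewrite ler_pM ?sqrtr_ge0.
apply: le_trans Z0 _; rewrite ler_peMl //.
by rewrite /Z addr_ge0 // !mulr_ge0 ?sqrtr_ge0 // ltW.
Qed.
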